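(* Let $F$ be a field and $F * A_1$, $F * A_2$ twisted group algebras of finitely generated free abelian groups $A_1,A_2$ over $F$ such that, for each $i\in\{1,2\}$: $\mathrm{codim}(F * A_i)\ge2$, $\dim(F * A_i)\ge2$, and $F * A_i$ has center $F$. Let $d=\dim(F * A_1\otimes_F F * A_2)$. Then $$d<\min\{\dim(F * A_1)+\mathrm{rk}(A_2),\ \dim(F * A_2)+\mathrm{rk}(A_1)\}-1.$$
   Context: A twisted group algebra $F * A$ is an $F$-algebra with $F$-basis $\{\bar a: a\in A\}$ and $\bar a_1\bar a_2=\tau(a_1,a_2)\overline{a_1a_2}$, $\tau$ a 2-cocycle with values in $F\setminus\{0\}$. The tensor product is a twisted group algebra of $A_1\times A_2$. $\dim$ denotes the Krull dimension, which for these algebras coincides with the global dimension; $\mathrm{rk}$ is the rank and $\mathrm{codim}(F * A)=\mathrm{rk}(A)-\dim(F * A)$. *)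

(* Defs.v *)
From HB Require Import structures.
From mathcomp Require Import all_boot all_order all_algebra.
Set Implicit Arguments. Unset Strict Implicit. Unset Printing Implicit Defensive.
Import Order.TTheory GRing.Theory Num.Theory.
Local Open Scope ring_scope.

(* 2-cocycle on an (additively written) abelian group A with values in F^x:
   bar a * bar b = tau a b * bar (a+b); associativity <-> cocycle identity. *)
Definition cocycle (F : fieldType) (A : zmodType) (tau : A -> A -> F) : Prop :=
  (forall a b, tau a b != 0) /\
  (forall a b c, tau a b * tau (a + b) c = tau b c * tau a (b + c)).

Definition twisted_group_algebra (F : fieldType) (A : zmodType) (R : algType F)
    (tau : A -> A -> F) (u : A -> R) : Prop :=
  [/\ cocycle tau,
      (forall (s : seq A) (c : A -> F), uniq s ->
          \sum_(a <- s) c a *: u a = 0 -> forall a, a \in s -> c a = 0),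
      (forall x : R, exists (s : seq A) (c : A -> F), x = \sum_(a <- s) c a *: u a) &
      (forall a b, u a * u b = tau a b *: u (a + b))].

(* Cocycle of the tensor product F*A1 (x)_F F*A2 = F*(A1 x A2). *)
Definition prod_cocycle (F : fieldType) (A1 A2 : zmodType)
    (tau1 : A1 -> A1 -> F) (tau2 : A2 -> A2 -> F) :
    (A1 * A2)%type -> (A1 * A2)%type -> F :=
  fun a b => tau1 a.1 b.1 * tau2 a.2 b.2.

Definition center_is_F (F : fieldType) (R : algType F) : Prop :=
  forall x : R, (forall y : R, x * y = y * x) -> exists c : F, x = c%:A.

Definition right_ideal (R : ringType) (I : R -> Prop) : Prop :=
  [/\ I 0, (forall x y, I x -> I y -> I (x - y)) & (forall x r, I x -> I (x * r))].

(* devlt k J I : the interval [J, I] of the lattice of right ideals has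
   (Gabriel-Rentschler) deviation < k, where deviation < 0 means trivial. *)
Fixpoint devlt (R : ringType) (k : nat) (J I : R -> Prop) : Prop :=
  match k with
  | 0 => forall x, I x -> J x
  | k'.+1 =>
      forall c : nat -> (R -> Prop),
        (forall i, right_ideal (c i)) ->
        (forall i x, J x -> c i x) ->
        (forall x, c 0 x -> I x) ->
        (forall i x, c i.+1 x -> c i x) ->
        exists N, forall i, (N <= i)%N -> devlt k' (c i.+1) (c i)
  end.

Definition krull_dim (R : ringType) (d : nat) : Prop :=
  devlt d.+1 (fun x : R => x = 0) (fun _ => True) /\
  ~ devlt d (fun x : R => x = 0) (fun _ => True).

(* Main.v *)
(** Write [lambda a b] for the scalar with [u a * u b = lambda a b *: (u b * u a)]. The
Krull dimension of [F*A] is the largest rank of a subgroup on which [lambda] takes values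
in roots of unity (an isotropic subgroup).

Lower bound: for commuting independent monomials [v_1, ..., v_r] the elements [v_i - 1]
form a regular sequence, and their powers give the required chains of right ideals.

Upper bound: give a subquotient [I/J] of [F*A] the dimension [max #|S|] over the sets [S] of
coordinates for which [I/J] is not torsion over [F*Z^S]. Leading exponents and Dickson's
lemma show that in a descending chain almost all factors have smaller dimension. A proper
right ideal [Q] is then degenerated: if [F*C/(Q ∩ F*C)] has infinite dimension over [F], a
limit direction of irreducible monomials orders [C], and the initial ideal of [Q] for this
order is proper and graded by a subgroup of smaller rank. The process ends with a non-zero
finite-dimensional module over some [F*C], where taking determinants shows that [C] is
isotropic; the dimension of [F*A/Q] is at least the corank of [C].

Finally let [W] be isotropic of maximal rank [d] in [A_1 x A_2], with [K] the part in [A_1].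
If [W] projects onto [A_2] (up to finite index), then, the radical of [A_2] being trivial, the
preimage of an isotropic subgroup of rank [d_2 >= 2] enlarges [K] to an isotropic subgroup of
[A_1] of rank [rk K + d_2]. Otherwise [d >= d_1 + rk A_2 - 1] makes [K] maximal isotropic, so
that [W = K x L] and [L] is isotropic of rank [rk A_2 - 1 > d_2]. *)

Require Import Defs.
From HB Require Import structures.
From mathcomp Require Import all_boot all_order all_algebra.
From mathcomp Require Import boolp filter.
From mathcomp Require Import zify ring.
Set Implicit Arguments. Unset Strict Implicit. Unset Printing Implicit Defensive.
Import Order.TTheory GRing.Theory Num.Theory.
Local Open Scope ring_scope.

(** * Maxima in finite lists and right ideals *)

Lemma exists_max (T : eqType) (le : T -> T -> Prop) (s : seq T) x0 : x0 \in s ->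
  (forall x y, x \in s -> y \in s -> le x y \/ le y x) ->
  (forall x y z, le x y -> le y z -> le x z) ->
  exists2 m, m \in s & forall x, x \in s -> le x m.
Proof.
move=> xs tot tr; elim: s x0 xs tot => // x1 s IH x0 _ tot; case: s IH tot => [|x2 s] IH tot.
  exists x1; rewrite ?inE // => x; rewrite inE => /eqP ->.
  by case: (tot x1 x1); rewrite ?mem_head.
have [|m ms hm] := IH x2 (mem_head _ _).
  by move=> x y xs ys; apply: tot; rewrite inE ?xs ?ys orbT.
have [|h|h] := tot x1 m (mem_head _ _); [by rewrite inE ms orbT|exists m|exists x1].
- by rewrite inE ms orbT.
- by move=> x; rewrite inE => /orP[/eqP ->|/hm].
- exact: mem_head.
- move=> x; rewrite inE => /orP[/eqP ->|/hm h']; last exact: tr h' h.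
  by case: (tot x1 x1); rewrite ?mem_head.
Qed.

Section RightIdeals.
Variables (R : nzRingType) (I : R -> Prop).
Hypothesis idI : right_ideal I.

Lemma ideal0 : I 0. Proof. by case: idI. Qed.
Lemma idealB x y : I x -> I y -> I (x - y). Proof. by case: idI => _ h _; exact: h. Qed.
Lemma idealM x r : I x -> I (x * r). Proof. by case: idI => _ _ h; exact: h. Qed.
Lemma idealN x : I x -> I (- x).
Proof. by move=> h; rewrite -sub0r; apply: idealB => //; exact: ideal0. Qed.
Lemma idealD x y : I x -> I y -> I (x + y).
Proof. by move=> hx hy; rewrite -[y]opprK; apply: idealB => //; exact: idealN. Qed.
Lemma ideal_sum (T : Type) (s : seq T) (f : T -> R) :
  (forall i, I (f i)) -> I (\sum_(i <- s) f i).
Proof. by move=> h; elim/big_ind: _ => // *; [exact: ideal0|exact: idealD]. Qed.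
End RightIdeals.

Lemma idealZ (F : fieldType) (R : algType F) (I : R -> Prop) c x :
  right_ideal I -> I x -> I (c *: x).
Proof. by move=> [_ _ h] Ix; have := h _ c%:A Ix; rewrite -scalerAr mulr1. Qed.

(** * Expansions in the monomial basis *)

Section Expansion.
Variables (F : fieldType) (A : zmodType) (R : algType F).
Implicit Types (u : A -> R) (x : R).

(** The list is the exact support, so two expansions of one element differ only in the order of the
    list. *)
Definition is_expansion u x (p : seq A * (A -> F)) : Prop :=
  [/\ uniq p.1, x = \sum_(a <- p.1) p.2 a *: u a & forall a, (a \in p.1) = (p.2 a != 0)].

(** The default value is never reached in a twisted group algebra, by [expansionP]. *)
Definition expansion u x : seq A * (A -> F) :=
  if pselect (exists p, is_expansion u x p) is left h then projT1 (cid h)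
  else ([::], fun _ => 0).

Definition msupp u x := (expansion u x).1.
Definition cf u x := (expansion u x).2.
Definition sup u (P : A -> Prop) x := forall a, cf u x a != 0 -> P a.
(** The linear projection onto the span of the monomials with exponent in [P], along the other
    monomials. *)
Definition res u (P : A -> Prop) x := \sum_(a <- msupp u x | `[< P a >]) cf u x a *: u a.
End Expansion.

Section Twisted.
Variables (F : fieldType) (A : zmodType) (R : algType F) (tau : A -> A -> F) (u : A -> R).
Hypothesis tw : twisted_group_algebra tau u.
Implicit Types (a b c : A) (x y z : R).

Let lin_indep (s : seq A) (c : A -> F) : uniq s ->
  \sum_(a <- s) c a *: u a = 0 -> forall a, a \in s -> c a = 0.
Proof. by case: tw => _ h _ _; exact: h. Qed.

Lemma umul a b : u a * u b = tau a b *: u (a + b).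
Proof. by case: tw. Qed.
Lemma tau_neq0 a b : tau a b != 0.
Proof. by case: tw => -[]. Qed.

(** The spanning axiom allows repeated indices; an index that occurs m times contributes m times its
    coefficient. *)
Lemma sum_undup (s : seq A) (f : A -> F) :
  exists g : A -> F, \sum_(a <- s) f a *: u a = \sum_(a <- undup s) g a *: u a.
Proof.
exists (fun a => f a *+ count_mem a s).
elim: s => [|a s IH]; first by rewrite !big_nil.
have e (t : seq A) : a \notin t -> \sum_(b <- t) (f b *+ count_mem b (a :: s)) *: u b
  = \sum_(b <- t) (f b *+ count_mem b s) *: u b.
  elim: t => [|b t IHt]; first by rewrite !big_nil.
  rewrite inE negb_or => /andP[/negPf h /IHt h2]; rewrite !big_cons h2 /=.
  by rewrite h.
rewrite big_cons IH /=; case: ifP => [ain|anin]; last first.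
  rewrite big_cons /= eqxx add1n mulrS (count_memPn _) ?anin // mulr0n addr0.
  by rewrite e // mem_undup anin.
have am : a \in undup s by rewrite mem_undup.
rewrite (big_rem a am) [in RHS](big_rem a am) /= eqxx addrA add1n mulrS scalerDl.
by rewrite e // (rem_filter _ (undup_uniq s)) mem_filter /= eqxx.
Qed.

Lemma expansionP x : is_expansion u x (expansion u x).
Proof.
rewrite /expansion; case: pselect => [h|[]]; first by case: cid.
case: tw => _ _ /(_ x)[s [c xE]] _.
have [g gE] := sum_undup s c.
pose t := [seq a <- undup s | g a != 0].
exists (t, fun a => if a \in t then g a else 0); split=> /=.
- by rewrite filter_uniq // undup_uniq.
- rewrite xE gE big_seq [RHS]big_seq /t [in RHS]big_filter_cond /= [LHS]big_mkcond [RHS]big_mkcond /=.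
  apply: eq_bigr => a _; rewrite mem_filter /=.
  by have [->|/=] := eqVneq (g a) 0; [rewrite scale0r; case: ifP|case: ifP].
- by move=> a; rewrite mem_filter /=; case: (g a =P 0) => [->|/eqP ga] /=;
    [rewrite eqxx|case: ifP; rewrite ?ga ?eqxx].
Qed.

Lemma msupp_uniq x : uniq (msupp u x). Proof. by case: (expansionP x). Qed.
Lemma mem_msupp x a : (a \in msupp u x) = (cf u x a != 0).
Proof. by case: (expansionP x). Qed.
Lemma expandE x : x = \sum_(a <- msupp u x) cf u x a *: u a.
Proof. by case: (expansionP x). Qed.

Let sum_sub (s t : seq A) (f : A -> F) : uniq s -> uniq t -> {subset s <= t} ->
  \sum_(a <- t) (if a \in s then f a else 0) *: u a = \sum_(a <- s) f a *: u a.
Proof.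
move=> us ut st; rewrite (eq_bigr (fun a => if a \in s then f a *: u a else 0)); last first.
  by move=> a _; case: ifP; rewrite ?scale0r.
rewrite -big_mkcond /= -big_filter; apply: perm_big.
apply: uniq_perm; rewrite ?filter_uniq // => a; rewrite mem_filter.
by case: (boolP (a \in s)) => // /st ->.
Qed.

(** Both expansions are padded with zeros to the union of the two lists, where linear independence
    compares them. *)
Lemma cf_unique x (s : seq A) (f : A -> F) : uniq s -> x = \sum_(a <- s) f a *: u a ->
  forall a, cf u x a = if a \in s then f a else 0.
Proof.
move=> us xE a; pose t := undup (s ++ msupp u x).
have ut : uniq t by exact: undup_uniq.
have st : {subset s <= t} by move=> b bs; rewrite mem_undup mem_cat bs.
have st' : {subset msupp u x <= t} by move=> b bs; rewrite mem_undup mem_cat bs orbT.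
have e := sum_sub (cf u x) (msupp_uniq x) ut st'; rewrite -expandE in e.
have e' := sum_sub f us ut st; rewrite -xE in e'.
have d : \sum_(b <- t) ((if b \in msupp u x then cf u x b else 0) -
    (if b \in s then f b else 0)) *: u b = 0.
  by rewrite (eq_bigr _ (fun b _ => scalerBl _ _ _)) sumrB e e' subrr.
have [at_|] := boolP (a \in t).
  have := lin_indep ut d at_; rewrite mem_msupp; move/eqP; rewrite subr_eq0 => /eqP <-.
  by case: eqP.
rewrite mem_undup mem_cat negb_or mem_msupp negbK => /andP[/negPf -> /eqP ->] //.
Qed.

Lemma cf_inj x y : (forall a, cf u x a = cf u y a) -> x = y.
Proof.
move=> h; rewrite (expandE x) (expandE y).
have -> : \sum_(a <- msupp u x) cf u x a *: u a = \sum_(a <- msupp u x) cf u y a *: u a.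
  by apply: eq_bigr => a _; rewrite h.
by apply: perm_big; apply: uniq_perm; rewrite ?msupp_uniq // => a; rewrite !mem_msupp h.
Qed.

Lemma cfD x y a : cf u (x + y) a = cf u x a + cf u y a.
Proof.
pose t := undup (msupp u x ++ msupp u y).
have ut : uniq t by exact: undup_uniq.
have st b : b \notin t -> cf u x b + cf u y b = 0.
  rewrite mem_undup mem_cat !mem_msupp negb_or !negbK => /andP[/eqP -> /eqP ->].
  by rewrite addr0.
rewrite (cf_unique (s := t) (f := fun b => cf u x b + cf u y b)) //.
  by case: ifP => // /negbT /st.
have ex z : {subset msupp u z <= t} -> z = \sum_(b <- t) cf u z b *: u b.
  move=> h; rewrite {1}(expandE z) -(sum_sub _ (msupp_uniq z) ut h); apply: eq_bigr => b _.
  by case: ifP => //; rewrite mem_msupp => /negbFE /eqP ->; rewrite !scale0r.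
rewrite (eq_bigr _ (fun b _ => scalerDl _ _ _)) big_split /= -!ex //.
  by move=> b; rewrite mem_undup mem_cat => ->; rewrite orbT.
by move=> b; rewrite mem_undup mem_cat => ->.
Qed.

Lemma cfZ k x a : cf u (k *: x) a = k * cf u x a.
Proof.
rewrite (cf_unique (s := msupp u x) (f := fun b => k * cf u x b)) ?msupp_uniq //.
  by case: ifP => //; rewrite mem_msupp => /negbFE /eqP ->; rewrite mulr0.
by rewrite {1}(expandE x) scaler_sumr; apply: eq_bigr => b _; rewrite scalerA.
Qed.

Lemma cfN x a : cf u (- x) a = - cf u x a.
Proof. by rewrite -scaleN1r cfZ mulN1r. Qed.
Lemma cfB x y a : cf u (x - y) a = cf u x a - cf u y a.
Proof. by rewrite cfD cfN. Qed.
Lemma cf0 a : cf u 0 a = 0.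
Proof. by rewrite -(subrr 0) cfB subrr. Qed.
Lemma cf_sum (T : Type) (s : seq T) (P : pred T) (f : T -> R) a :
  cf u (\sum_(i <- s | P i) f i) a = \sum_(i <- s | P i) cf u (f i) a.
Proof. by apply: (big_morph (fun x => cf u x a)) => [x y|]; rewrite ?cfD ?cf0. Qed.
Lemma cf_u b a : cf u (u b) a = (a == b)%:R.
Proof.
rewrite (cf_unique (s := [:: b]) (f := fun=> 1)) ?big_seq1 ?scale1r // inE.
by case: eqP.
Qed.

Lemma cf_neq0 x : x <> 0 -> exists a, cf u x a != 0.
Proof.
move=> xn; apply: contrapT => h; apply: xn; apply: cf_inj => a; rewrite cf0.
by apply: contrapT => /eqP ha; apply: h; exists a.
Qed.

Lemma cf_mulu x b a : cf u (x * u b) a = cf u x (a - b) * tau (a - b) b.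
Proof.
rewrite {1}(expandE x) mulr_suml cf_sum.
rewrite (eq_bigr (fun c => if c == a - b then cf u x (a - b) * tau (a - b) b else 0)).
  rewrite -big_mkcond big_const_seq iter_addr_0.
  rewrite (@eq_count _ _ (pred1 (a - b))) // count_uniq_mem ?msupp_uniq // mem_msupp.
  by case: eqP => [->|]; rewrite ?mul0r ?mulr1n.
move=> c _; rewrite -scalerAl umul scalerA cfZ cf_u.
have -> : (a == c + b) = (c == a - b) by rewrite [RHS]eq_sym subr_eq.
by case: eqP => [->|]; rewrite ?mulr1 ?mulr0.
Qed.

Lemma cf_umul x b a : cf u (u b * x) a = tau b (a - b) * cf u x (a - b).
Proof.
rewrite {1}(expandE x) mulr_sumr cf_sum.
rewrite (eq_bigr (fun c => if c == a - b then tau b (a - b) * cf u x (a - b) else 0)).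
  rewrite -big_mkcond big_const_seq iter_addr_0.
  rewrite (@eq_count _ _ (pred1 (a - b))) // count_uniq_mem ?msupp_uniq // mem_msupp.
  by case: eqP => [->|]; rewrite ?mulr0 ?mulr1n.
move=> c _; rewrite -scalerAr umul scalerA cfZ cf_u.
have -> : (a == b + c) = (c == a - b) by rewrite [RHS]eq_sym subr_eq addrC.
by case: eqP => [->|]; rewrite ?mulr1 ?mulr0 // mulrC.
Qed.

Lemma cf_mul_sup x y a : cf u (x * y) a != 0 ->
  exists b c, [/\ cf u x b != 0, cf u y c != 0 & a = b + c].
Proof.
rewrite {1}(expandE y) mulr_sumr cf_sum => h; apply: contrapT => n.
move/eqP: h; apply; rewrite big_seq; apply: big1 => c; rewrite mem_msupp => cy.
rewrite -scalerAr cfZ cf_mulu; case: (cf u x (a - c) =P 0) => [->|/eqP hx].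
  by rewrite mul0r mulr0.
by case: n; exists (a - c), c; split => //; rewrite subrK.
Qed.

(** This is the cocycle identity at [0, 0, b] after cancelling [tau 0 b]. Cocycles are not
    normalised, so [u 0] is only a scalar multiple of 1. *)
Lemma tau0l b : tau 0 b = tau 0 0.
Proof.
case: tw => -[nz] /(_ 0 0 b) h _ _ _; move: h; rewrite !add0r => h.
by apply/esym/(mulIf (nz 0 b)); rewrite h.
Qed.

Lemma u0E : u 0 = (tau 0 0)%:A.
Proof.
have h y : u 0 * y = tau 0 0 *: y.
  rewrite (expandE y) mulr_sumr scaler_sumr; apply: eq_bigr => b _.
  by rewrite -scalerAr umul add0r tau0l !scalerA mulrC.
by rewrite -[u 0]mulr1 h.
Qed.

Lemma oneE : 1 = (tau 0 0)^-1 *: u 0.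
Proof. by rewrite u0E scalerA mulVf ?scale1r // tau_neq0. Qed.

Lemma cf1 a : cf u 1 a != 0 -> a = 0.
Proof. by rewrite oneE cfZ cf_u; case: (a =P 0); rewrite ?mulr0 ?eqxx. Qed.

Definition uinv a := (tau a (- a) * tau 0 0)^-1 *: u (- a).

Lemma umulV a : u a * uinv a = 1.
Proof.
rewrite -scalerAr umul scalerA subrr u0E scalerA -mulrA.
by rewrite mulVf ?scale1r // mulf_neq0 // tau_neq0.
Qed.

Lemma uVmul a : uinv a * u a = 1.
Proof.
(* A left inverse of [u a], which must then agree with the right inverse [uinv a]. *)
pose k := ((tau (- a) a) * tau 0 0)^-1 *: u (- a).
have h : k * u a = 1.
  rewrite -scalerAl umul scalerA addNr u0E scalerA -mulrA.
  by rewrite mulVf ?scale1r // mulf_neq0 // tau_neq0.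
by rewrite -[uinv a]mul1r -h -(mulrA k) umulV mulr1.
Qed.

Lemma u_neq0 a : u a <> 0.
Proof. by move/(congr1 (fun x => cf u x a)); rewrite cf_u eqxx cf0 => /eqP; rewrite oner_eq0. Qed.

Lemma umulI a x y : u a * x = u a * y -> x = y.
Proof. by move/(congr1 (fun z => uinv a * z)); rewrite !mulrA uVmul !mul1r. Qed.

Lemma cf_res (P : A -> Prop) x a : cf u (res u P x) a = if `[< P a >] then cf u x a else 0.
Proof.
rewrite /res -big_filter (cf_unique (s := [seq b <- msupp u x | `[< P b >]]) (f := cf u x)) //.
  by rewrite mem_filter mem_msupp; case: `[< P a >] => //=; case: eqP.
by rewrite filter_uniq // msupp_uniq.
Qed.

Lemma cf_resT (P : A -> Prop) x a : P a -> cf u (res u P x) a = cf u x a.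
Proof. by move=> h; rewrite cf_res asboolT. Qed.
Lemma cf_resF (P : A -> Prop) x a : ~ P a -> cf u (res u P x) a = 0.
Proof. by move=> h; rewrite cf_res asboolF. Qed.

Lemma resD (P : A -> Prop) x y : res u P (x + y) = res u P x + res u P y.
Proof. by apply: cf_inj => a; rewrite cfD !cf_res; case: ifP; rewrite ?cfD ?addr0. Qed.
Lemma resZ (P : A -> Prop) k x : res u P (k *: x) = k *: res u P x.
Proof. by apply: cf_inj => a; rewrite cfZ !cf_res; case: ifP; rewrite ?cfZ ?mulr0. Qed.
Lemma resN (P : A -> Prop) x : res u P (- x) = - res u P x.
Proof. by rewrite -!scaleN1r resZ. Qed.
Lemma resB (P : A -> Prop) x y : res u P (x - y) = res u P x - res u P y.
Proof. by rewrite resD resN. Qed.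
Lemma res0 (P : A -> Prop) : res u P 0 = 0.
Proof. by apply: cf_inj => a; rewrite cf_res cf0 if_same. Qed.
Lemma res_eq (P Q : A -> Prop) x :
  (forall a, cf u x a != 0 -> (P a <-> Q a)) -> res u P x = res u Q x.
Proof.
move=> h; apply: cf_inj => a; rewrite !cf_res.
have [-> //|/h h'] := eqVneq (cf u x a) 0; first by rewrite !if_same.
by rewrite (asbool_equiv_eq h').
Qed.
Lemma res_id (P : A -> Prop) x : sup u P x -> res u P x = x.
Proof.
move=> h; apply: cf_inj => a; have [h0|/h h'] := eqVneq (cf u x a) 0; last exact: cf_resT.
by rewrite cf_res h0 if_same.
Qed.
Lemma res_none (P : A -> Prop) x : sup u (fun a => ~ P a) x -> res u P x = 0.
Proof.
move=> h; apply: cf_inj => a; rewrite cf0; have [h0|/h h'] := eqVneq (cf u x a) 0.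
  by rewrite cf_res h0 if_same.
exact: cf_resF.
Qed.
Lemma res_mulu (P : A -> Prop) x b : res u (fun a => P (a - b)) (x * u b) = res u P x * u b.
Proof.
apply: cf_inj => a; rewrite cf_mulu !cf_res cf_mulu.
by case: ifP; rewrite ?mul0r.
Qed.
Lemma res_umul (P : A -> Prop) x b : res u (fun a => P (a - b)) (u b * x) = u b * res u P x.
Proof.
apply: cf_inj => a; rewrite cf_umul !cf_res cf_umul.
by case: ifP; rewrite ?mulr0.
Qed.

Lemma sup_ind (K : R -> Prop) (P : A -> Prop) x :
  K 0 -> (forall x y, K x -> K y -> K (x + y)) -> (forall k x, K x -> K (k *: x)) ->
  (forall a, P a -> K (u a)) -> sup u P x -> K x.
Proof.
move=> K0 KD KZ Ku h; rewrite (expandE x) big_seq.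
elim/big_ind: _ => // a; rewrite mem_msupp => /h /Ku; exact: KZ.
Qed.

Lemma sup0 (P : A -> Prop) : sup u P 0.
Proof. by move=> a; rewrite cf0 eqxx. Qed.
Lemma supD (P : A -> Prop) x y : sup u P x -> sup u P y -> sup u P (x + y).
Proof.
move=> hx hy a; rewrite cfD; have [->|/hx //] := eqVneq (cf u x a) 0.
by rewrite add0r => /hy.
Qed.
Lemma supZ (P : A -> Prop) k x : sup u P x -> sup u P (k *: x).
Proof. by move=> hx a; rewrite cfZ mulf_eq0 negb_or => /andP[_ /hx]. Qed.
Lemma supN (P : A -> Prop) x : sup u P x -> sup u P (- x).
Proof. by move=> h; rewrite -scaleN1r; exact: supZ. Qed.
Lemma supB (P : A -> Prop) x y : sup u P x -> sup u P y -> sup u P (x - y).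
Proof. by move=> hx hy; apply: supD => //; exact: supN. Qed.
Lemma supW (P Q : A -> Prop) x : (forall a, P a -> Q a) -> sup u P x -> sup u Q x.
Proof. by move=> h hx a /hx /h. Qed.
Lemma sup_u (P : A -> Prop) a : P a -> sup u P (u a).
Proof. by move=> Pa b; rewrite cf_u; have [->|_] := eqVneq b a; rewrite ?eqxx. Qed.
Lemma supM (P Q S : A -> Prop) x y : (forall a b, P a -> Q b -> S (a + b)) ->
  sup u P x -> sup u Q y -> sup u S (x * y).
Proof. by move=> h hx hy a /cf_mul_sup[b [c [/hx Pb /hy Qc ->]]]; exact: h. Qed.
Lemma sup1 (P : A -> Prop) : P 0 -> sup u P 1.
Proof. by move=> P0 a /cf1 ->. Qed.

(** Multiplication by a monomial with exponent in the subgroup [C] maps every coset of [C] to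
    itself, hence commutes with the projection onto a coset. *)
Lemma res_coset_mul (C : A -> Prop) a x y : (forall b c, C b -> C c -> C (b - c)) ->
  sup u C y -> res u (fun b => C (b - a)) (x * y) = res u (fun b => C (b - a)) x * y.
Proof.
move=> hC; apply: (sup_ind (K := fun y => res u (fun b => C (b - a)) (x * y) =
  res u (fun b => C (b - a)) x * y)).
- by rewrite !mulr0 res0.
- by move=> y1 y2; rewrite !mulrDr resD => -> ->.
- by move=> k z; rewrite -!scalerAr resZ => ->.
move=> c Cc; rewrite -res_mulu; apply: res_eq => b _.
have C0 : C 0 by rewrite -(subrr c); apply: hC.
have e : b - c - a = b - a - c by rewrite addrAC.
split; rewrite e => h; first exact: hC.
rewrite -(subrK c (b - a)) -[X in C (_ + X)]opprK; apply: (hC) => //.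
by rewrite -sub0r; exact: hC.
Qed.

Lemma res_coset_lmul (C : A -> Prop) a x y : (forall b c, C b -> C c -> C (b - c)) ->
  sup u C y -> res u (fun b => C (b - a)) (y * x) = y * res u (fun b => C (b - a)) x.
Proof.
move=> hC; apply: (sup_ind (K := fun y => res u (fun b => C (b - a)) (y * x) =
  y * res u (fun b => C (b - a)) x)).
- by rewrite !mul0r res0.
- by move=> y1 y2; rewrite !mulrDl resD => -> ->.
- by move=> k z; rewrite -!scalerAl resZ => ->.
move=> c Cc; rewrite -res_umul; apply: res_eq => b _.
have C0 : C 0 by rewrite -(subrr c); apply: hC.
have e : b - c - a = b - a - c by rewrite addrAC.
split; rewrite e => h; first exact: hC.
rewrite -(subrK c (b - a)) -[X in C (_ + X)]opprK; apply: (hC) => //.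
by rewrite -sub0r; exact: hC.
Qed.

End Twisted.

(** * Dickson's lemma along an ultrafilter *)

(** The last field combines properness and freeness: members of [U] are unbounded, in particular
    non-empty. *)
Record free_ultrafilter (U : (nat -> Prop) -> Prop) : Prop := FreeUltrafilter {
  ultraS : forall P Q : nat -> Prop, (forall k, P k -> Q k) -> U P -> U Q;
  ultraI : forall P Q, U P -> U Q -> U (fun k => P k /\ Q k);
  ultraC : forall P, U P \/ U (fun k => ~ P k);
  ultra_ex : forall P N, U P -> exists2 k, (N <= k)%N & P k }.

Lemma free_ultrafilter_exists : exists U, free_ultrafilter U.
Proof.
have [U [Uult sub]] := ultraFilterLemma eventually_filter.
exists U; split.
- by move=> P Q PQ; apply: filterS.
- by move=> P Q; exact: filterI.
- by move=> P; have [|] := in_ultra_setVsetC P Uult; [left|right].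
- move=> P N UP.
  have UN : U (fun k => (N <= k)%N) by apply: sub; exists N.
  by have [k [Pk Nk]] := filter_ex (filterI UP UN); exists k.
Qed.

Section Ultra.
Variable U : (nat -> Prop) -> Prop.
Hypothesis ultraU : free_ultrafilter U.

Lemma ultraT (P : nat -> Prop) : (forall k, P k) -> U P.
Proof.
by move=> h; have [//|h'] := ultraC ultraU P; apply: (ultraS ultraU) h' => k [].
Qed.

Lemma ultra_forall (I : finType) (P : I -> nat -> Prop) :
  (forall i, U (P i)) -> U (fun k => forall i, P i k).
Proof.
move=> h; suff : U (fun k => forall i, i \in enum I -> P i k).
  by apply: (ultraS ultraU) => k hk i; apply: hk; rewrite mem_enum.
elim: (enum I) => [|i s IH]; first exact: ultraT.
apply: (ultraS ultraU) (ultraI ultraU (h i) IH) => k [hi hs] j.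
by rewrite inE => /orP[/eqP ->|/hs].
Qed.

Lemma ultra_bounded_const (g : nat -> nat) K :
  U (fun k => (g k <= K)%N) -> exists v, U (fun k => g k = v).
Proof.
elim: K => [|K IH] h.
  by exists 0%N; apply: (ultraS ultraU) h => k; rewrite leqn0 => /eqP.
have [h'|h'] := ultraC ultraU (fun k => (g k <= K)%N); first exact: IH.
exists K.+1; apply: (ultraS ultraU) (ultraI ultraU h h') => k [le /negP].
by rewrite -ltnNge => lt; apply/eqP; rewrite eqn_leq le.
Qed.

(* Along U every coordinate is eventually constant or tends to infinity; T collects the latter. *)
Lemma dickson (I : finType) (g : nat -> I -> nat) :
  exists (i : nat) (T : pred I), forall K N, exists2 k, (N <= k)%N &
    forall j, if T j then (g i j + K <= g k j)%N else g k j == g i j.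
Proof.
pose T j := `[< forall K, U (fun k => (K <= g k j)%N) >].
have hT j : exists v, ~~ T j -> U (fun k => g k j = v).
  have [//|/asboolPn nT] := boolP (T j); first by exists 0%N.
  suff [v hv] : exists v, U (fun k => g k j = v) by exists v.
  have [K hK] : exists K, ~ U (fun k => (K <= g k j)%N).
    by apply: contrapT => h; apply: nT => K; apply: contrapT => h'; apply: h; exists K.
  have [//|h] := ultraC ultraU (fun k => (K <= g k j)%N).
  apply: (@ultra_bounded_const _ K); apply: (ultraS ultraU) h => k /negP.
  by rewrite -ltnNge => /ltnW.
have [v hv] := choice hT.
have hU : U (fun k => forall j, ~~ T j -> g k j = v j).
  apply: ultra_forall => j; have [_|nT] := boolP (T j); first exact: ultraT.
  by apply: (ultraS ultraU) (hv j nT).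
have [i _ hi] := ultra_ex ultraU 0%N hU.
exists i, T => K N.
have hU' : U (fun k => forall j, T j -> (g i j + K <= g k j)%N).
  apply: ultra_forall => j; have [/asboolP Tj|_] := boolP (T j); last exact: ultraT.
  by apply: (ultraS ultraU) (Tj (g i j + K)%N).
have [k Nk [h1 h2]] := ultra_ex ultraU N (ultraI ultraU hU hU').
exists k => // j; case: ifPn => [/h2//|nT].
by rewrite h1 ?hi.
Qed.

End Ultra.

(** * Leading exponents and chains of right ideals *)

Section Lex.
Variable n : nat.
Implicit Types (a b : 'rV[int]_n) (s t : seq 'I_n).

(** The strict lexicographic order along the list [s]: the first non-zero coordinate is negative.
    Thus [lexneg s (b - a)] places [b] below [a]. *)
Fixpoint lexneg s a : bool :=
  if s is j :: s' then (a ord0 j < 0) || ((a ord0 j == 0) && lexneg s' a) else false.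

Lemma lexnegD s a b : lexneg s a -> lexneg s b -> lexneg s (a + b).
Proof.
elim: s => //= j s IH; rewrite !mxE.
move=> /orP[ha|/andP[/eqP ha sa]] /orP[hb|/andP[/eqP hb sb]]; apply/orP.
- by left; rewrite -[0]addr0 ltrD.
- by left; rewrite hb addr0.
- by left; rewrite ha add0r.
- by right; rewrite ha hb addr0 eqxx IH.
Qed.

Lemma lexneg_zero s a b : (forall j, j \in s -> b ord0 j = 0) -> lexneg s (a + b) = lexneg s a.
Proof.
elim: s => //= j s IH h; rewrite !mxE h ?mem_head // addr0 IH //.
by move=> i si; apply: h; rewrite inE si orbT.
Qed.

Lemma lexneg_total s a : [\/ lexneg s a, lexneg s (- a) | forall j, j \in s -> a ord0 j = 0].
Proof.
elim: s => [|j s IH] /=; first by constructor 3.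
rewrite !mxE; have [lt|gt|e] := ltgtP (a ord0 j) 0.
- by constructor 1.
- by constructor 2; rewrite oppr_lt0 gt.
case: IH => h; [constructor 1|constructor 2|constructor 3].
- by rewrite h orbT.
- by rewrite e oppr0 eqxx h orbT.
- by move=> i; rewrite inE => /orP[/eqP ->|/h].
Qed.

Lemma lexneg_nonneg s a : (forall j, j \in s -> 0 <= a ord0 j) -> ~~ lexneg s a.
Proof.
elim: s => //= j s IH h; rewrite negb_or -leNgt h ?mem_head // negb_and IH ?orbT //.
by move=> i si; apply: h; rewrite inE si orbT.
Qed.

Lemma lexneg_cat s t a : lexneg (s ++ t) a -> lexneg s a \/ forall j, j \in s -> a ord0 j = 0.
Proof.
elim: s => [|j s IH] /=; first by right.
case/orP => [->|/andP[/eqP e /IH[->|h]]]; [by left|by left; rewrite e eqxx orbT|right].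
by move=> i; rewrite inE => /orP[/eqP ->|/h].
Qed.

Lemma lexneg_asym s a : lexneg s a -> ~~ lexneg s (- a).
Proof.
move=> h; apply/negP => /(lexnegD h); rewrite subrr; apply/negP.
by apply: lexneg_nonneg => j _; rewrite mxE.
Qed.
End Lex.

(** * Leading exponents, the Ore condition and descending chains *)

Section Chain.
Variables (F : fieldType) (n : nat) (R : algType F).
Variables (tau : 'rV[int]_n -> 'rV[int]_n -> F) (u : 'rV[int]_n -> R).
Hypothesis tw : twisted_group_algebra tau u.
Local Notation A := 'rV[int]_n.
Implicit Types (a b : A) (x y z : R) (S : {set 'I_n}) (I J : R -> Prop).

(** This is the subgroup Z^S. The monoid [nonneg_off S] allows any sign on [S]; Dickson's lemma is
    applied to the other coordinates. *)
Definition coord_subgroup S a := forall j, j \notin S -> a ord0 j = 0.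
Definition nonneg_off S a := forall j, j \notin S -> 0 <= a ord0 j.

Lemma coordD S a b : coord_subgroup S a -> coord_subgroup S b -> coord_subgroup S (a + b).
Proof. by move=> ha hb j jS; rewrite mxE ha // hb. Qed.
Lemma coordN S a : coord_subgroup S a -> coord_subgroup S (- a).
Proof. by move=> ha j jS; rewrite mxE ha ?oppr0. Qed.
Lemma coordB S a b : coord_subgroup S a -> coord_subgroup S b -> coord_subgroup S (a - b).
Proof. by move=> ha hb; apply: coordD => //; exact: coordN. Qed.
Lemma coord0 S : coord_subgroup S 0.
Proof. by move=> j _; rewrite mxE. Qed.
Lemma coord_nonneg S a : coord_subgroup S a -> nonneg_off S a.
Proof. by move=> h j /h ->. Qed.
Lemma nonnegD S a b : nonneg_off S a -> nonneg_off S b -> nonneg_off S (a + b).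
Proof. by move=> ha hb j jS; rewrite mxE addr_ge0 ?ha ?hb. Qed.

Definition torsion_over S J I := forall x, I x ->
  exists z, [/\ z <> 0, sup u (coord_subgroup S) z & J (x * z)].

Definition elim_neg S a := lexneg (enum (~: S)) a.
(** An elimination order: coordinates outside [S] are compared first, so a descent is either strict
    outside [S] or stays in one coset of Z^S. *)
Definition elim_order S := enum (~: S) ++ enum S.

Lemma mem_elim_order S j : j \in elim_order S.
Proof. by rewrite mem_cat !mem_enum inE orNb. Qed.

Lemma elim_order_total S a : [\/ a = 0, lexneg (elim_order S) a | lexneg (elim_order S) (- a)].
Proof.
case: (lexneg_total (elim_order S) a) => h; [constructor 2|constructor 3|constructor 1] => //.
by apply/rowP => j; rewrite mxE h // mem_elim_order.
Qed.

Lemma elim_order_cases S a : lexneg (elim_order S) a -> elim_neg S a \/ coord_subgroup S a.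
Proof.
move=> /lexneg_cat[|h]; [by left|right=> j jS].
by apply: h; rewrite mem_enum inE.
Qed.

Lemma elim_negD S a b : elim_neg S a -> coord_subgroup S b -> elim_neg S (a + b).
Proof.
by move=> ha hb; rewrite /elim_neg lexneg_zero // => j; rewrite mem_enum inE => /hb.
Qed.

Definition lead S x a := cf u x a != 0 /\
  forall b, cf u x b != 0 -> b = a \/ lexneg (elim_order S) (b - a).

Lemma lead_exists S x : x <> 0 -> exists a, lead S x a.
Proof.
move=> /(cf_neq0 tw)[a0]; rewrite -(mem_msupp tw) => a0s.
have [||a] := @exists_max _ (fun a b => a = b \/ lexneg (elim_order S) (a - b)) _ _ a0s.
- move=> a b _ _; case: (elim_order_total S (a - b)) => [/eqP|h|h].
  + by rewrite subr_eq0 => /eqP; left; left.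
  + by left; right.
  + by right; right; rewrite -opprB.
- move=> a b c [->//|h] [<-|h']; first by right.
  by right; have := lexnegD h h'; rewrite addrA subrK.
rewrite (mem_msupp tw) => xa h; exists a; split=> // b.
by rewrite -(mem_msupp tw) => /h.
Qed.

(** The coefficient at [a + b] comes from the single pair [(a, b)] and is a product of non-zero
    scalars. Hence [R] is a domain. *)
Lemma leadM S x y a b : lead S x a -> lead S y b -> lead S (x * y) (a + b).
Proof.
move=> [xa hx] [yb hy]; split.
  have ym : b \in msupp u y by rewrite (mem_msupp tw).
  rewrite {1}(expandE tw y) mulr_sumr (cf_sum tw) (bigD1_seq b ym (msupp_uniq tw y)) /=.
  rewrite big_seq_cond big1 ?addr0.
    rewrite -scalerAr (cfZ tw) (cf_mulu tw) addrK.
    by rewrite !mulf_neq0 // (tau_neq0 tw).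
  move=> c /andP[]; rewrite (mem_msupp tw) => /hy[->|hc]; first by rewrite eqxx.
  move=> cb; rewrite -scalerAr (cfZ tw) (cf_mulu tw).
  have [->|/hx[/eqP|h]] := eqVneq (cf u x (a + b - c)) 0; first by rewrite mul0r mulr0.
    by rewrite -addrA -subr_eq0 addrAC subrr add0r subr_eq0 eq_sym (negbTE cb).
  by have := lexneg_asym hc; rewrite opprB; move: h; rewrite addrAC [a + b]addrC addrK => ->.
move=> c /(cf_mul_sup tw)[a' [b' [/hx ha' /hy hb' ->]]].
case: ha' => [->|ha']; case: hb' => [->|hb']; [by left|right|right|right];
  rewrite opprD addrACA.
- by rewrite subrr add0r.
- by rewrite subrr addr0.
- exact: lexnegD.
Qed.

Lemma mulr_neq0 x y : x <> 0 -> y <> 0 -> x * y <> 0.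
Proof.
move=> /(lead_exists set0)[a xa] /(lead_exists set0)[b yb] e.
by case: (leadM xa yb); rewrite e (cf0 tw) eqxx.
Qed.

Lemma shift_nonneg S x : exists b, sup u (nonneg_off S) (x * u b).
Proof.
(* The sum of the absolute values over the support outweighs every negative coordinate of every
   exponent. *)
exists (\sum_(a <- msupp u x) \row_j `|a ord0 j|) => c.
rewrite (cf_mulu tw) mulf_eq0 negb_or => /andP[xc _] j _.
rewrite -(subrK (\sum_(a <- msupp u x) \row_i `|a ord0 i|) c).
move: xc; set c' := c - _; rewrite -(mem_msupp tw) => c's.
rewrite mxE summxE (big_rem c' c's) /= mxE addrA addr_ge0 //.
  by have := ler_norm (- c' ord0 j); rewrite normrN lerNl -subr_ge0 opprK.
by apply: sumr_ge0 => a _; rewrite mxE.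
Qed.

(** Leading exponents are taken modulo Z^S, so that only the natural numbers outside [S] matter. The
    role of a leading coefficient is played by a whole element of [F*Z^S]. *)
Definition lead_exps S I a := exists x a',
  [/\ I x, sup u (nonneg_off S) x, lead S x a' & coord_subgroup S (a' - a)].

Lemma lead_exps_nonneg S I a : lead_exps S I a -> nonneg_off S a.
Proof.
move=> [x [a' [_ sx [/sx ha _] h]]] j jS; have := ha j jS; have := h j jS.
by rewrite !mxE => /eqP; rewrite subr_eq0 => /eqP ->.
Qed.

Lemma lead_expsS S I J a : (forall x, I x -> J x) -> lead_exps S I a -> lead_exps S J a.
Proof. by move=> h [x [a' [/h]]]; exists x, a'. Qed.

Lemma lead_u S a : lead S (u a) a.
Proof.
split; first by rewrite (cf_u tw) eqxx oner_neq0.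
by move=> b; rewrite (cf_u tw); have [->|_] := eqVneq b a; [left|rewrite eqxx].
Qed.

Lemma lead_exps_up S I a b : right_ideal I -> lead_exps S I a -> nonneg_off S (b - a) ->
  lead_exps S I b.
Proof.
move=> idI [x [a' [Ix sx la h]]] nb; exists (x * u (b - a)), (a' + (b - a)); split.
- exact: idealM.
- apply: (supM tw (P := nonneg_off S) (Q := nonneg_off S)) => //; first exact: nonnegD.
  exact: (sup_u tw).
- by apply: leadM => //; exact: lead_u.
- by rewrite -addrA addrAC subrr sub0r.
Qed.

Definition ore S := forall r r', r <> 0 -> r' <> 0 ->
  sup u (coord_subgroup S) r -> sup u (coord_subgroup S) r' ->
  exists s s', [/\ s <> 0, sup u (coord_subgroup S) s, sup u (coord_subgroup S) s' & r * s = r' * s'].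

(** Dickson's lemma finds a later term that dominates an earlier one outside [S], while the
    accumulated difference should be lexicographically negative there. *)
Lemma no_descent S (f : nat -> A) : (forall k, nonneg_off S (f k)) ->
  ~ (forall k, elim_neg S (f k.+1 - f k)).
Proof.
move=> nn desc; have [U ultraU] := free_ultrafilter_exists.
have [i [T h]] := dickson ultraU (fun k (j : 'I_n) => if j \in S then 0%N else `|f k ord0 j|%N).
have [k ik hk] := h 0%N i.+1.
have {}desc l : elim_neg S (f (i + l.+1)%N - f i).
  elim: l => [|l IH]; first by rewrite addn1.
  by have h' := lexnegD (desc (i + l.+1)%N) IH; rewrite addrA subrK in h'; rewrite addnS.
have := desc (k - i.+1)%N; rewrite addnS -addSn subnKC //; apply/negP.
apply: lexneg_nonneg => j; rewrite mem_enum inE => jS; have := hk j.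
rewrite (negbTE jS) !mxE subr_ge0; have := nn i j jS; have := nn k j jS.
by move: (f i ord0 j) (f k ord0 j) => p q; case: ifP => _; lia.
Qed.

(* Division with remainder: the leading coefficients, which lie in the twisted
   algebra of the coordinate subgroup, are matched by the Ore condition. *)
Lemma lead_exps_torsion S I J : ore S -> right_ideal I -> right_ideal J ->
  (forall x, J x -> I x) -> (forall a, lead_exps S I a -> lead_exps S J a) -> torsion_over S J I.
Proof.
move=> oreS idI idJ JI EIJ.
pose good x := exists z, [/\ z <> 0, sup u (coord_subgroup S) z & J (x * z)].
suff main x : I x -> sup u (nonneg_off S) x -> good x.
  (* A monomial shift makes the exponents non-negative outside [S]; the multiplier found for the
     shifted element is conjugated back by the same monomial. *)
  move=> x Ix; have [b sb] := shift_nonneg S x.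
  have [z [z0 sz Jz]] := main _ (idealM idI (u b) Ix) sb.
  exists (u b * z * u (- b)); split.
  - by apply: mulr_neq0; [apply: mulr_neq0 => //|]; exact: (u_neq0 tw).
  - move=> a /(cf_mul_sup tw)[b' [c' [/(cf_mul_sup tw)[b1 [c1 [h1 h2 ->]]] h3 ->]]].
    have -> : b1 = b by move: h1; rewrite (cf_u tw); case: (b1 =P b); rewrite ?eqxx.
    have -> : c' = - b by move: h3; rewrite (cf_u tw); case: (c' =P _); rewrite ?eqxx.
    by rewrite addrAC subrr add0r; exact: sz.
  - by rewrite !mulrA; exact: idealM.
apply: contrapT => nmain.
(* The leading exponents of counterexamples. Below, [step] lowers such an exponent strictly outside
   [S], which starts the infinite descent excluded by [no_descent]. *)
pose bad a := exists x, [/\ I x, sup u (nonneg_off S) x, lead S x a & ~ good x].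
have good0 : good 0.
  exists 1; split; [by apply/eqP; rewrite oner_neq0| |by rewrite mul0r; exact: ideal0].
  by apply: (sup1 tw); exact: coord0.
have step a : bad a -> exists2 b, bad b & elim_neg S (b - a).
  move=> [y [Iy sy lya ngy]].
  have [|w [a' [Jw sw lwa' a'a]]] := EIJ a.
    by exists y, a; split=> //; rewrite subrr; exact: coord0.
  (* The component on the coset of [a] serves as leading coefficient; multiplying by [u (- a)] moves
     it into [F*Z^S]. *)
  pose top v := res u (fun b => coord_subgroup S (b - a)) v.
  have low v c : cf u v c != 0 -> (lead S v a \/ lead S v a') ->
      elim_neg S (c - a) \/ coord_subgroup S (c - a).
    move=> vc [|] [_ /(_ c vc)].
      by case=> [->|/elim_order_cases//]; right; rewrite subrr; exact: coord0.
    have e : c - a = (c - a') + (a' - a) by rewrite addrA subrK.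
    case=> [->|/elim_order_cases[h|h]]; first by right.
      by left; rewrite e; exact: elim_negD.
    by right; rewrite e; exact: coordD.
  have topn v b : lead S v b -> coord_subgroup S (b - a) -> top v <> 0.
    move=> [vb _] h /(congr1 (fun z => cf u z b)); rewrite (cf_resT tw) // (cf0 tw).
    exact/eqP.
  have topS v : sup u (coord_subgroup S) (u (- a) * top v).
    move=> c /(cf_mul_sup tw)[b1 [c1 [h1 h2 ->]]].
    have -> : b1 = - a by move: h1; rewrite (cf_u tw); case: (b1 =P _); rewrite ?eqxx.
    move: h2; rewrite /top (cf_res tw); case: asboolP => [h _|]; last by rewrite eqxx.
    by rewrite addrC.
  have aa : coord_subgroup S (a - a) by rewrite subrr; exact: coord0.
  have [||||s [s' [s0 ss ss' e]]] := oreS (u (- a) * top y) (u (- a) * top w) => //.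
  - by apply: mulr_neq0; [exact: (u_neq0 tw)|exact: topn lya aa].
  - by apply: mulr_neq0; [exact: (u_neq0 tw)|exact: topn lwa' a'a].
  pose v := y * s - w * s'.
  have Iv : I v by apply: idealB => //; apply: idealM => //; exact: JI.
  have sv : sup u (nonneg_off S) v.
    apply: (supB tw); apply: (supM tw (P := nonneg_off S) (Q := coord_subgroup S)) => //;
      by move=> b c hb hc; apply: nonnegD => //; exact: coord_nonneg.
  have ngv : ~ good v.
    move=> [z [z0 sz Jz]]; apply: ngy; exists (s * z); split.
    - exact: mulr_neq0.
    - by apply: (supM tw (P := coord_subgroup S) (Q := coord_subgroup S)) => //; exact: coordD.
    - rewrite mulrA -(subrK (w * s') (y * s)) mulrDl; apply: idealD => //.
      by apply: idealM => //; exact: idealM.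
  have [b lb] : exists b, lead S v b.
    by apply: lead_exists => v0; apply: ngv; rewrite v0.
  exists b; first by exists v.
  (* The Ore multipliers make the two leading coefficients cancel, so the leading exponent of [v]
     leaves the coset of [a]. *)
  have topv : top v = 0.
    have CB c d : coord_subgroup S c -> coord_subgroup S d -> coord_subgroup S (c - d) by exact: coordB.
    rewrite /top /v (resB tw) !(res_coset_mul tw a _ CB) // -!/(top _).
    apply/eqP; rewrite subr_eq0; apply/eqP; apply: (umulI tw (a := - a)).
    by rewrite !mulrA.
  have nb : ~ coord_subgroup S (b - a) by move=> h; exact: (topn v b lb h).
  have [d [t [dl ts bE]]] : exists d t, [/\ elim_neg S (d - a) \/ coord_subgroup S (d - a),
      coord_subgroup S t & b = d + t].
    have [vb _] := lb; move: vb; rewrite /v (cfB tw).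
    have [->|/(cf_mul_sup tw)[d [t [yd /ss ts ->]]] _] := eqVneq (cf u (y * s) b) 0.
      rewrite sub0r oppr_eq0 => /(cf_mul_sup tw)[d [t [wd /ss' ts ->]]].
      by exists d, t; split=> //; apply: low wd _; right.
    by exists d, t; split=> //; apply: low yd _; left.
  move: nb; rewrite bE addrAC; case: dl => h nb; first exact: elim_negD.
  by case: nb; exact: coordD.
have [a0 bad0] : exists a, bad a.
  have /not_implyP[Ix /not_implyP[sx ngx]] := nmain.
  have [|a la] := @lead_exists S x; first by move=> e; apply: ngx; rewrite e.
  by exists a, x.
have [nxt hnxt] : exists f : A -> A, forall a, bad a -> bad (f a) /\ elim_neg S (f a - a).
  have [f hf] : {f : A -> A & forall a, bad a -> bad (f a) /\ elim_neg S (f a - a)}.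
    apply: (choice (P := fun a b => bad a -> bad b /\ elim_neg S (b - a))) => a.
    have [/step[b]|nb] := EM (bad a); first by exists b.
    by exists a.
  by exists f.
have hb k : bad (iter k nxt a0) by elim: k => //= k /hnxt[].
apply: (@no_descent S (fun k => iter k nxt a0)).
  by move=> k; have [y [_ sy [ya _] _]] := hb k; exact: sy.
by move=> k; have [] := hnxt _ (hb k).
Qed.

Lemma coord_set0 a : coord_subgroup set0 a -> a = 0.
Proof. by move=> h; apply/rowP => j; rewrite mxE h // inE. Qed.

(** For empty [S] the algebra [F*Z^S] is the commutative field [F]. This case makes
    [lead_exps_torsion] available for the proof of the general Ore condition. *)
Lemma ore_set0 : ore set0.
Proof.
move=> r r' r0 r'0 sr sr'; exists r', r; split=> //.
have sc x : sup u (coord_subgroup set0) x -> exists k : F, x = k%:A.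
  move=> sx; exists (cf u x 0 * tau 0 0).
  rewrite -scalerA -(u0E tw); apply: (cf_inj tw) => a; rewrite (cfZ tw) (cf_u tw).
  have [->|a0] := eqVneq a 0; first by rewrite mulr1.
  rewrite mulr0; apply/eqP; apply/negPn/negP => /sx /coord_set0 e.
  by rewrite e eqxx in a0.
have [k ->] := sc r sr; have [k' ->] := sc r' sr'.
by rewrite -!scalerAl !mul1r !scalerA mulrC.
Qed.

(** If [t 0] is non-zero, isolating its term exhibits a common right multiple; otherwise a factor
    [r] cancels on the left and [k] drops. *)
Lemma common_multiple_of_relation (r r' : R) : r <> 0 -> r' <> 0 ->
  forall k (b : R) (t : nat -> R), b <> 0 -> r ^+ k * r' * b = \sum_(i < k) r ^+ i * r' * t i ->
  exists s s' : R, s <> 0 /\ r' * s = r * s'.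
Proof.
move=> r0 r'0; elim=> [|k IH] b t b0.
  by rewrite big_ord0 expr0 mul1r => /(mulr_neq0 r'0 b0).
rewrite big_ord_recl expr0 mul1r => e.
have e' : r * (r ^+ k * r' * b - \sum_(i < k) r ^+ i * r' * t i.+1) = r' * t 0%N.
  rewrite mulrBr !mulrA -exprS e mulr_sumr [X in _ - X](eq_bigr (fun i : 'I_k => r ^+ i.+1 * r' * t i.+1)).
    by rewrite addrK.
  by move=> i _; rewrite !mulrA -exprS.
have [t0|/eqP t0] := eqVneq (t 0%N) 0; last by eexists; eexists; split; [exact: t0|exact/esym/e'].
apply: (IH b (fun i => t i.+1) b0); apply/eqP; rewrite -subr_eq0; apply/eqP.
by apply: contrapT => /(mulr_neq0 r0); rewrite e' t0 mulr0.
Qed.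

(** By Dickson's lemma the leading exponents of the ascending right ideals [L k] stabilise at some
    step. There [r' ^+ k * r] is torsion modulo [L k], which is a relation of the preceding kind. *)
Lemma common_multiple (r r' : R) : r <> 0 -> r' <> 0 -> exists s s' : R, s <> 0 /\ r * s = r' * s'.
Proof.
move=> r'0 r0; pose L k x := exists t : nat -> R, x = \sum_(i < k) r' ^+ i * r * t i.
have idL k : right_ideal (L k).
  split.
  - by exists (fun=> 0); rewrite big1 // => i _; rewrite mulr0.
  - move=> _ _ [t ->] [t' ->]; exists (fun i => t i - t' i).
    by rewrite -sumrB; apply: eq_bigr => i _; rewrite mulrBr.
  - move=> _ s [t ->]; exists (fun i => t i * s).
    by rewrite mulr_suml; apply: eq_bigr => i _; rewrite mulrA.
have LS k x : L k x -> L k.+1 x.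
  move=> [t ->]; exists (fun i => if (i < k)%N then t i else 0).
  rewrite big_ord_recr /= ltnn mulr0 addr0; apply: eq_bigr => i _.
  by rewrite ltn_ord.
have Lle k l x : (k <= l)%N -> L k x -> L l x.
  by move=> /subnK <-; elim: (l - k)%N => //= m IH /IH; exact: LS.
suff [k hk] : exists k, forall a, lead_exps set0 (L k.+1) a -> lead_exps set0 (L k) a.
  have [|b [b0 _ [t e]]] := lead_exps_torsion ore_set0 (idL k.+1) (idL k) (LS k) hk (x := r' ^+ k * r).
    exists (fun i => (i == k)%:R); rewrite big_ord_recr /= eqxx mulr1 big1 ?add0r // => i _.
    by rewrite ltn_eqF ?mulr0.
  exact: (common_multiple_of_relation r0 r'0 b0 e).
apply: contrapT => h.
have [f hf] : {f : nat -> A & forall k, lead_exps set0 (L k.+1) (f k) /\ ~ lead_exps set0 (L k) (f k)}.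
  apply: (choice (P := fun k a => lead_exps set0 (L k.+1) a /\
    ~ lead_exps set0 (L k) a)) => k.
  apply: contrapT => nh; apply: h; exists k => a ha.
  by apply: contrapT => h'; apply: nh; exists a.
have [U ultraU] := free_ultrafilter_exists.
have [i [T hT]] := dickson ultraU (fun k (j : 'I_n) => `|f k ord0 j|%N).
have [k ik hk] := hT 0%N i.+1; have [_] := hf k; apply.
have [fi _] := hf i.
apply: (lead_exps_up (a := f i) (idL k)); first by apply: lead_expsS fi => x; exact: Lle.
move=> j jS; have := hk j; have := lead_exps_nonneg fi jS.
have := lead_exps_nonneg (hf k).1 jS; rewrite !mxE subr_ge0.
by move: (f i ord0 j) (f k ord0 j) => p q; case: ifP => _; lia.
Qed.

(** A common multiple in [R] is projected onto one coset of Z^S that meets the support of [s] and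
    then translated back. Left multiplication by [r] and [r'] respects the projection. *)
Lemma oreP S : ore S.
Proof.
move=> r r' r0 r'0 sr sr'; have [s [s' [s0 e]]] := common_multiple r0 r'0.
have [a sa] := cf_neq0 tw s0.
have CB c d : coord_subgroup S c -> coord_subgroup S d -> coord_subgroup S (c - d) by exact: coordB.
pose top v := res u (fun b => coord_subgroup S (b - a)) v.
have st v : sup u (coord_subgroup S) (top v * u (- a)).
  move=> c /(cf_mul_sup tw)[b1 [c1 [h1 h2 ->]]].
  have -> : c1 = - a by move: h2; rewrite (cf_u tw); case: (c1 =P _); rewrite ?eqxx.
  by move: h1; rewrite /top (cf_res tw); case: asboolP => [h _|]; last by rewrite eqxx.
exists (top s * u (- a)), (top s' * u (- a)); split=> //.
  apply: mulr_neq0; last exact: (u_neq0 tw).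
  move=> /(congr1 (fun z => cf u z a)); rewrite (cf_resT tw) ?(cf0 tw) ?subrr; last exact: coord0.
  exact/eqP.
by rewrite !mulrA -!(res_coset_lmul tw a _ CB) // e.
Qed.

(** The torsion dimension of [I/J] is smaller than [g]. *)
Definition dim_lt g J I := forall S, #|S| = g -> torsion_over S J I.

(** If leading exponents never stabilised, Dickson's lemma would apply to a sequence of exponents
    each lost at the next ideal. If no coordinate outside [S] is unbounded, a lost exponent recurs
    later. If coordinate [j] is, torsion over [j |: S] puts an element of [J] with exponent on the
    ray in direction [j], and a later exponent lies above it, hence is not lost. *)
Lemma dim_lt_chain g J I (c : nat -> R -> Prop) : right_ideal J -> right_ideal I ->
  dim_lt g.+1 J I -> (forall i, right_ideal (c i)) -> (forall i x, J x -> c i x) ->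
  (forall x, c 0%N x -> I x) -> (forall i x, c i.+1 x -> c i x) ->
  exists N, forall i, (N <= i)%N -> dim_lt g (c i.+1) (c i).
Proof.
move=> idJ idI dJI idc Jc cI dec.
have cle i l x : (i <= l)%N -> c l x -> c i x.
  by move=> /subnK <-; elim: (l - i)%N => //= m IH /dec; exact: IH.
have ciI i x : c i x -> I x by move=> /(cle 0%N i x (leq0n _)); exact: cI.
suff h S : exists N, #|S| = g -> forall i, (N <= i)%N -> torsion_over S (c i.+1) (c i).
  have [N hN] := choice h; exists (\max_S N S) => i Ni S Sg.
  by apply: hN => //; apply: leq_trans Ni; exact: leq_bigmax.
have [Sg|] := EM (#|S| = g); last by exists 0%N.
suff [N hN] : exists N, forall i, (N <= i)%N ->
    forall a, lead_exps S (c i) a -> lead_exps S (c i.+1) a.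
  exists N => _ i /hN hi; apply: lead_exps_torsion => //; [exact: oreP|exact: dec].
apply: contrapT => nst.
have [f hf] : {f : nat -> nat * A & forall k, [/\ (k <= (f k).1)%N,
    lead_exps S (c (f k).1) (f k).2 & ~ lead_exps S (c (f k).1.+1) (f k).2]}.
  apply: (choice (P := fun k (p : nat * A) => [/\ (k <= p.1)%N,
    lead_exps S (c p.1) p.2 & ~ lead_exps S (c p.1.+1) p.2])) => k.
  apply: contrapT => nh; apply: nst; exists k => i ki a ha.
  by apply: contrapT => h'; apply: nh; exists (i, a).
have [U ultraU] := free_ultrafilter_exists.
have [k0 [T hT]] := dickson ultraU
  (fun k (j : 'I_n) => if j \in S then 0%N else `|(f k).2 ord0 j|%N).
have [_ fk0 nfk0] := hf k0; have nn0 := lead_exps_nonneg fk0.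
have [[j jS Tj]|nT] := EM (exists2 j, j \notin S & T j); last first.
  have [k kk0 hk] := hT 0%N (f k0).1.+1; apply: nfk0.
  have [kfk fk _] := hf k; have nnk := lead_exps_nonneg fk.
  apply: (lead_exps_up (a := (f k).2)) => //.
    by apply: lead_expsS fk => x; apply: cle; exact: leq_trans kfk.
  move=> j jS; have := hk j; have := nn0 j jS; have := nnk j jS; rewrite !mxE (negbTE jS).
  case: ifP => Tj; first by case: nT; exists j.
  by move: ((f k0).2 ord0 j) ((f k).2 ord0 j) => p q; lia.
have [K hK] : exists K : nat, lead_exps S J ((f k0).2 + \row_i (K%:Z *+ (i == j))).
  have [x [a [cx sx lx ha]]] := fk0.
  have [|z [z0 sz Jxz]] := dJI (j |: S) _ x (ciI _ _ cx); first by rewrite cardsU1 jS Sg.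
  have [b sb] := shift_nonneg S z.
  (* Only coordinate [j] has to be made non-negative: the exponents of [z] already vanish elsewhere
     outside [S]. *)
  pose b' : A := \row_i (b ord0 i *+ (i == j)).
  have sb' : sup u (fun a => coord_subgroup (j |: S) a /\ nonneg_off S a) (z * u b').
    move=> d zd; have /(cf_mul_sup tw)[d1 [d2 [h1 h2 dE]]] := zd.
    have d2E : d2 = b' by move: h2; rewrite (cf_u tw); case: (d2 =P _); rewrite ?eqxx.
    have hd : coord_subgroup (j |: S) d.
      move=> i; rewrite dE d2E => ij; rewrite !mxE (sz _ h1) // add0r.
      by move: ij; rewrite in_setU1 negb_or => /andP[/negbTE -> _]; rewrite mulr0n.
    split=> // i iS; have [->|ij] := eqVneq i j; last by rewrite hd // in_setU1 negb_or ij.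
    have hs : cf u (z * u b) (d1 + b) != 0.
      by rewrite (cf_mulu tw) addrK mulf_neq0 // (tau_neq0 tw).
    by have := sb _ hs j jS; rewrite dE d2E !mxE eqxx.
  have zb0 : z * u b' <> 0 by apply: mulr_neq0 => //; exact: (u_neq0 tw).
  have [d ld] := lead_exists S zb0.
  have [hd nnd] := sb' d ld.1.
  exists `|d ord0 j|%N, (x * (z * u b')), (a + d); split.
  - by rewrite mulrA; exact: idealM.
  - apply: (supM tw (P := nonneg_off S) (Q := nonneg_off S)) => //; first exact: nonnegD.
    by apply: (supW (u := u)) sb' => ? [].
  - exact: leadM.
  - move=> i iS; rewrite opprD addrACA mxE ha // add0r !mxE.
    have [->|ij] := eqVneq i j; last first.
      by rewrite (hd i) ?in_setU1 ?negb_or ?ij // mulr0n subrr.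
    by rewrite mulr1n gez0_abs ?subrr // nnd.
have [k kk0 hk] := hT K 0%N.
have [kfk fk nfk] := hf k; have nnk := lead_exps_nonneg fk; apply: nfk.
apply: (lead_exps_up (idc _) (lead_expsS (Jc _) hK)).
move=> i iS; have := hk i; have := nn0 i iS; have := nnk i iS; rewrite !mxE (negbTE iS).
have [->|ij] := eqVneq i j.
  by rewrite Tj mulr1n; move: ((f k0).2 ord0 j) ((f k).2 ord0 j) => p q; lia.
rewrite mulr0n; move: ((f k0).2 ord0 i) ((f k).2 ord0 i) => p q.
by case: ifP => _; lia.
Qed.
End Chain.

(** * Initial ideals *)

Section CommFactor.
Variables (F : fieldType) (A : zmodType) (R : algType F) (tau : A -> A -> F) (u : A -> R).
Hypothesis tw : twisted_group_algebra tau u.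
Implicit Types (a b c : A).

Definition comm_factor a b : F := tau a b / tau b a.

Lemma comm_factor_neq0 a b : comm_factor a b != 0.
Proof. by rewrite mulf_neq0 ?invr_neq0 // (tau_neq0 tw). Qed.

Lemma comm_factorE a b : u a * u b = comm_factor a b *: (u b * u a).
Proof. by rewrite !(umul tw) [b + a]addrC scalerA divfK ?(tau_neq0 tw). Qed.

Lemma comm_factor_unique a b (k : F) : u a * u b = k *: (u b * u a) -> k = comm_factor a b.
Proof.
rewrite comm_factorE !(umul tw) !scalerA => /(congr1 (fun x => cf u x (b + a))).
rewrite !(cfZ tw) (cf_u tw) eqxx !mulr1 => /esym; apply: mulIf.
exact: (tau_neq0 tw).
Qed.

(** Moving [u c] past [u a * u b] one factor at a time collects both scalars. *)
Lemma comm_factorDl a b c : comm_factor (a + b) c = comm_factor a c * comm_factor b c.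
Proof.
apply/esym/comm_factor_unique.
have t0 := tau_neq0 tw a b.
apply: (scalerI t0); rewrite scalerAl -(umul tw) -mulrA (comm_factorE b c) -scalerAr mulrA.
rewrite (comm_factorE a c) -scalerAl -mulrA (umul tw a b) -scalerAr !scalerA.
by congr (_ *: _); ring.
Qed.

Lemma comm_factorC a b : comm_factor b a = (comm_factor a b)^-1.
Proof. by rewrite /comm_factor invfM invrK mulrC. Qed.

End CommFactor.

Section Degeneration.
Variables (F : fieldType) (A : zmodType) (R : algType F) (tau : A -> A -> F) (u : A -> R).
Hypothesis tw : twisted_group_algebra tau u.
Implicit Types (a b c : A) (x y z : R).

(** A subgroup with torsion-free quotient; [coset_graded] is homogeneity for the grading of [R] by
    that quotient. *)
Definition isolated (C : A -> Prop) := [/\ C 0, forall a b, C a -> C b -> C (a - b) &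
  forall a k, C (a *+ k.+1) -> C a].

Definition coset_graded (C : A -> Prop) (Q : R -> Prop) :=
  forall x a, Q x -> Q (res u (fun b => C (b - a)) x).

Lemma isolatedN C a : isolated C -> C a -> C (- a).
Proof. by move=> [C0 CB _] Ca; rewrite -sub0r; exact: CB. Qed.
Lemma isolatedD C a b : isolated C -> C a -> C b -> C (a + b).
Proof. by move=> h Ca Cb; rewrite -[b]opprK; have [_ CB _] := h; apply: CB => //; exact: isolatedN. Qed.

(** A total preorder on [C] is given by its strictly negative elements [neg] and by [C0], the
    elements equivalent to 0. The hypothesis [proper] excludes elements of [Q] whose part outside
    [neg] is 1. *)
Variables (C : A -> Prop) (Q : R -> Prop) (neg C0 : A -> Prop).
Hypotheses (isoC : isolated C) (idQ : right_ideal Q) (grQ : coset_graded C Q).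
Hypotheses (negD : forall a b, neg a -> neg b -> neg (a + b))
  (negC0 : forall a b, neg a -> C0 b -> neg (a + b)) (isoC0 : isolated C0)
  (total : forall a, C a -> [\/ neg a, neg (- a) | C0 a])
  (proper : forall y, sup u neg y -> ~ Q (1 - y)).

Definition initial_part a z := exists y,
  [/\ Q y, sup u (fun b => C0 (b - a) \/ neg (b - a)) y & res u (fun b => C0 (b - a)) y = z].

(** Requiring each [C0]-coset component to be an initial part makes the ideal homogeneous by
    construction. *)
Definition initial_ideal x := forall a, initial_part a (res u (fun b => C0 (b - a)) x).

Lemma initial_part0 a : initial_part a 0.
Proof. by exists 0; split; [exact: ideal0|exact: (sup0 tw)|exact: (res0 tw)]. Qed.

Lemma initial_partD a x y : initial_part a x -> initial_part a y -> initial_part a (x + y).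
Proof.
move=> [x' [Qx sx <-]] [y' [Qy sy <-]]; exists (x' + y'); split.
- exact: idealD.
- exact: (supD tw).
- exact: (resD tw).
Qed.

Lemma initial_partZ a k x : initial_part a x -> initial_part a (k *: x).
Proof.
move=> [x' [Qx sx <-]]; exists (k *: x'); split.
- exact: (idealZ k idQ).
- exact: (supZ tw).
- exact: (resZ tw).
Qed.

Lemma coset_shift a b c : c - b - (a - b) = c - a.
Proof. by rewrite opprB addrA subrK. Qed.

Lemma initial_right_ideal : right_ideal initial_ideal.
Proof.
have D x y : initial_ideal x -> initial_ideal y -> initial_ideal (x + y).
  by move=> hx hy a; rewrite (resD tw); apply: initial_partD.
have Z k x : initial_ideal x -> initial_ideal (k *: x).
  by move=> hx a; rewrite (resZ tw); apply: initial_partZ.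
have O : initial_ideal 0 by move=> a; rewrite (res0 tw); exact: initial_part0.
split=> //.
  by move=> x y hx hy; rewrite -scaleN1r; apply: D => //; apply: Z.
move=> x r hx; apply: (sup_ind tw (K := fun r => initial_ideal (x * r)) (P := fun _ => True)) => //.
- by rewrite mulr0.
- by move=> r1 r2; rewrite mulrDr; exact: D.
- by move=> k r1; rewrite -scalerAr; exact: Z.
move=> b _ a; have [y [Qy sy yE]] := hx (a - b).
exists (y * u b); split; first exact: idealM.
  move=> c; rewrite (cf_mulu tw) mulf_eq0 negb_or => /andP[/sy + _].
  by rewrite coset_shift.
have e z : res u (fun c => C0 (c - a)) (z * u b) = res u (fun c => C0 (c - (a - b))) z * u b.
  by rewrite -(res_mulu tw); apply: (res_eq tw) => c _; rewrite coset_shift.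
by rewrite !e yE.
Qed.

Lemma res_res a a' x : res u (fun b => C0 (b - a')) (res u (fun b => C0 (b - a)) x) =
  if `[< C0 (a - a') >] then res u (fun b => C0 (b - a')) x else 0.
Proof.
have [_ CB _] := isoC0; apply: (cf_inj tw) => c; rewrite !(cf_res tw).
case: (asboolP (C0 (a - a'))) => h; last first.
  rewrite (cf0 tw); case: asboolP => // h1; case: asboolP => // h2; case: h.
  by have := CB _ _ h1 h2; rewrite opprB addrC addrA subrK.
rewrite (cf_res tw); case: asboolP => // h1; case: asboolP => // h2; case: h2.
by have := CB _ _ h1 h; rewrite opprB addrA subrK.
Qed.

Lemma initial_graded : coset_graded C0 initial_ideal.
Proof.
move=> x a hx a'; rewrite res_res; case: asboolP => _; [exact: hx|exact: initial_part0].
Qed.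

(** An element [y] of [Q] with initial part 1 would have [1 - y] supported in [neg], against
    [proper]. *)
Lemma initial_proper : ~ initial_ideal 1.
Proof.
have [C00 _ _] := isoC0.
move=> /(_ 0)[y [Qy sy e]]; apply: (proper (y := 1 - y)); last by rewrite opprB addrC subrK.
have e1 : res u (fun b => C0 (b - 0)) 1 = 1.
  by apply: (res_id tw) => b /(cf1 tw) ->; rewrite subr0.
rewrite e1 in e => a ha; have [h|h] := EM (C0 a).
  move: ha; rewrite (cfB tw) -{1}e (cf_resT tw) ?subrr ?eqxx ?subr0 //.
have : cf u y a != 0.
  apply: contra_neqN ha => /eqP ya; rewrite (cfB tw) ya subr0 -e (cf_resF tw) ?subr0 //.
by move=> /sy; rewrite subr0 => -[].
Qed.

(** One [C]-coset component of [b] still lies in [Q]; its part of maximal exponent class modulo [C0]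
    is initial. Only components are taken, so the support stays in [P], and [meets_coord] will
    survive a degeneration. *)
Lemma initial_nonzero (P : A -> Prop) (b : R) : b <> 0 -> sup u P b -> Q b ->
  exists2 z, z <> 0 & sup u P z /\ initial_ideal z.
Proof.
move=> /(cf_neq0 tw)[a ba] sb Qb.
have [C00 CB0 _] := isoC0; have [C'0 CB _] := isoC.
pose b1 := res u (fun c => C (c - a)) b.
have sb1 c : cf u b1 c != 0 -> C (c - a).
  by rewrite (cf_res tw); case: asboolP => // _; rewrite eqxx.
have a1 : a \in msupp u b1 by rewrite (mem_msupp tw) (cf_resT tw) ?subrr.
have [||m] := @exists_max _ (fun x y : A => C0 (x - y) \/ neg (x - y)) _ _ a1.
- move=> x y; rewrite !(mem_msupp tw) => /sb1 hx /sb1 hy.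
  have : C (x - y) by have := CB _ _ hx hy; rewrite opprB addrA subrK.
  move=> /total[h|h|h]; [by left; right|right; right|by left; left].
  by rewrite -opprB.
- move=> x y z hx hy; have -> : x - z = (x - y) + (y - z) by rewrite addrA subrK.
  case: hx hy => hx [] hy.
  + by left; apply: isolatedD.
  + by right; rewrite addrC; exact: negC0.
  + by right; exact: negC0.
  + by right; exact: negD.
rewrite (mem_msupp tw) => mb hm.
exists (res u (fun c => C0 (c - m)) b1).
  move=> /(congr1 (fun x => cf u x m)); rewrite (cf_resT tw) ?subrr // (cf0 tw).
  exact/eqP.
split.
  move=> c; rewrite !(cf_res tw); case: asboolP => _; rewrite ?eqxx //.
  by case: asboolP => _; rewrite ?eqxx // => /sb.
move=> a'; rewrite res_res; case: asboolP => h; last exact: initial_part0.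
exists b1; split=> //; first exact: grQ.
move=> c; rewrite -(mem_msupp tw) => /hm; have -> : c - a' = c - m + (m - a') by rewrite addrA subrK.
by case=> h'; [left; apply: isolatedD|right; exact: negC0].
Qed.
End Degeneration.

(** * Finite-dimensional quotients and determinants *)

Section FiniteQuotient.
Variables (F : fieldType) (A : zmodType) (R : algType F) (tau : A -> A -> F) (u : A -> R).
Hypothesis tw : twisted_group_algebra tau u.
Variables (C : A -> Prop) (Q : R -> Prop).
Hypotheses (isoC : isolated C) (idQ : right_ideal Q) (properQ : ~ Q 1).

Definition finite_quotient := exists X : seq A, (forall a, a \in X -> C a) /\
  forall a, C a -> exists y, sup u (fun b => b \in X) y /\ Q (u a - y).

(** The matrix of right multiplication by [r] modulo [Q]. With basis elements indexing rows,
    products keep their order. *)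
Definition represents k (t : 'I_k -> A) r (M : 'M[F]_k) :=
  forall i, Q (u (t i) * r - \sum_j M i j *: u (t j)).

Lemma representsM k (t : 'I_k -> A) r s M N :
  represents t r M -> represents t s N -> represents t (r * s) (M *m N).
Proof.
move=> hr hs i.
have e : u (t i) * (r * s) - \sum_j (M *m N) i j *: u (t j) =
   (u (t i) * r - \sum_j M i j *: u (t j)) * s + \sum_j M i j *: (u (t j) * s - \sum_l N j l *: u (t l)).
  rewrite mulrBl mulrA (eq_bigr _ (fun j _ => scalerBr _ _ _)) sumrB mulr_suml.
  rewrite [X in _ - X + _](eq_bigr (fun j => M i j *: (u (t j) * s))); last first.
    by move=> j _; rewrite scalerAl.
  rewrite addrA subrK; congr (_ - _); rewrite (eq_bigr _ (fun j _ => scaler_sumr _ _ _ _)) exchange_big /=.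
  apply: eq_bigr => l _; rewrite mxE scaler_suml; apply: eq_bigr => j _; by rewrite scalerA.
rewrite e; apply: idealD => //; first exact: idealM.
by apply: ideal_sum => // j; exact: (idealZ _ idQ).
Qed.

Lemma representsZ k (t : 'I_k -> A) r M c : represents t r M -> represents t (c *: r) (c *: M).
Proof.
move=> hr i; have := idealZ c idQ (hr i); rewrite scalerBr scaler_sumr -scalerAr.
by rewrite (eq_bigr (fun j => (c *: M) i j *: u (t j))) // => j _; rewrite mxE scalerA.
Qed.

Lemma sup_seq_sum k (t : 'I_k -> A) y : sup u (fun b => b \in codom t) y ->
  exists f : 'I_k -> F, y = \sum_j f j *: u (t j).
Proof.
apply: (sup_ind tw (K := fun y => exists f : 'I_k -> F, y = \sum_j f j *: u (t j))).
- by exists (fun=> 0); rewrite big1 // => j _; rewrite scale0r.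
- move=> _ _ [f ->] [g ->]; exists (fun j => f j + g j).
  by rewrite -big_split; apply: eq_bigr => j _; rewrite scalerDl.
- move=> c _ [f ->]; exists (fun j => c * f j).
  by rewrite scaler_sumr; apply: eq_bigr => j _; rewrite scalerA.
move=> b /codomP[j ->]; exists (fun i => (i == j)%:R).
rewrite (bigD1 j) //= eqxx scale1r big1 ?addr0 // => i /negbTE ->.
by rewrite scale0r.
Qed.

(* Choosing the spanning family of minimal size makes it a basis of the quotient. *)
Lemma finite_quotient_basis : finite_quotient -> exists k (t : 'I_k -> A),
  [/\ (0 < k)%N, forall i, C (t i),
   forall a, C a -> exists f : 'I_k -> F, Q (u a - \sum_j f j *: u (t j)) &
   forall f : 'I_k -> F, Q (\sum_j f j *: u (t j)) -> forall j, f j = 0].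
Proof.
move=> [X [XC hX]].
pose P k := `[< exists t : 'I_k -> A, (forall i, C (t i)) /\
  forall a, C a -> exists f : 'I_k -> F, Q (u a - \sum_j f j *: u (t j)) >].
have exP : exists k, P k.
  exists (size X); apply/asboolP; exists (tnth (in_tuple X)); split.
    by move=> i; apply: XC; exact: mem_tnth.
  move=> a /hX[y [sy Qy]].
  have [|f fE] := @sup_seq_sum _ (tnth (in_tuple X)) y; last by exists f; rewrite -fE.
  apply: (supW (u := u)) sy => b /seq_tnthP /=[i ->]; exact: codom_f.
case: (ex_minnP exP) => k /asboolP[t [tC ht]] kmin.
exists k, t; split=> //.
  case: k t tC ht {kmin} => // t tC ht; case: properQ.
  have [C0 _ _] := isoC; have [f] := ht 0 C0; rewrite big_ord0 subr0 => Qu.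
  by rewrite (oneE tw); exact: (idealZ _ idQ).
move=> f Qf j; apply: contrapT => /eqP fj.
case: k t tC ht kmin f Qf j fj => [|k] t tC ht kmin f Qf j fj; first by case: j {fj}.
suff : (k.+1 <= k)%N by rewrite ltnn.
(* A relation with [f j] non-zero expresses [u (t j)] through the other monomials, so dropping [t j]
   contradicts minimality. *)
apply: kmin; apply/asboolP; exists (fun i => t (lift j i)); split=> // a Ca.
have [g Qg] := ht a Ca; pose q := g j / f j.
exists (fun i => g (lift j i) - q * f (lift j i)).
have -> : u a - \sum_i (g (lift j i) - q * f (lift j i)) *: u (t (lift j i)) =
    (u a - \sum_i g i *: u (t i)) + q *: \sum_i f i *: u (t i).
  rewrite (bigD1_ord j) // [X in _ + q *: X](bigD1_ord j) //=.
  rewrite (eq_bigr _ (fun i _ => scalerBl _ _ _)) sumrB scalerDr scalerA divfK //.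
  rewrite scaler_sumr [X in _ = _ + (_ + X)](eq_bigr (fun i => (q * f (lift j i)) *: u (t (lift j i)))); last first.
    by move=> i _; rewrite scalerA.
  by rewrite opprB opprD -[RHS]addrA addrACA addNr add0r [X in _ = _ + X]addrC.
by apply: idealD => //; exact: (idealZ _ idQ).
Qed.

(* Taking determinants in u a * u b = comm_factor a b * u b * u a on the quotient. *)
Lemma finite_quotient_torsion : finite_quotient -> exists2 k, (0 < k)%N &
  forall a b, C a -> C b -> comm_factor tau a b ^+ k = 1.
Proof.
move=> /finite_quotient_basis[k [t [k0 tC span free]]]; exists k => //.
have ex a : C a -> exists M, represents t (u a) M.
  move=> Ca; have h i : exists f : 'I_k -> F, Q (u (t i) * u a - \sum_j f j *: u (t j)).
    have [f Qf] := span _ (isolatedD isoC (tC i) Ca).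
    exists (fun j => tau (t i) a * f j); have := idealZ (tau (t i) a) idQ Qf.
    rewrite scalerBr scaler_sumr (umul tw).
    by rewrite (eq_bigr (fun j => (tau (t i) a * f j) *: u (t j))) // => j _; rewrite scalerA.
  have [f hf] := choice h; exists (\matrix_(i, j) f i j) => i.
  by rewrite (eq_bigr (fun j => f i j *: u (t j))) // => j _; rewrite mxE.
have uniq r M N : represents t r M -> represents t r N -> M = N.
  move=> hM hN; apply/matrixP => i j; apply/eqP; rewrite -subr_eq0; apply/eqP.
  apply: (free (fun j => M i j - N i j)).
  have := idealB idQ (hN i) (hM i).
  rewrite opprB addrC addrA subrK -sumrB.
  rewrite (eq_bigr (fun j => (M i j - N i j) *: u (t j))) // => l _; by rewrite scalerBl.
have one : represents t 1 1%:M.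
  move=> i; rewrite mulr1 (bigD1 i) //= mxE eqxx scale1r big1 ?addr0 ?subrr; first exact: ideal0.
  by move=> j ji; rewrite mxE eq_sym (negbTE ji) scale0r.
(* The inverse of [u a] is a multiple of [u (- a)], so it too is represented by a matrix. *)
have detn0 a M : C a -> represents t (u a) M -> \det M != 0.
  move=> Ca hM; have [N hN] := ex _ (isolatedN isoC Ca).
  have h1 := representsM hM (representsZ (tau a (- a) * tau 0 0)^-1 hN).
  rewrite -/(uinv tau u a) (umulV tw) in h1.
  have := uniq _ _ _ h1 one => /(congr1 determinant); rewrite det_mulmx det1 => e.
  by apply: contra_eq_neq e => ->; rewrite mul0r eq_sym oner_neq0.
move=> a b Ca Cb; have [M hM] := ex a Ca; have [N hN] := ex b Cb.
have h1 := representsM hM hN; have h2 := representsZ (comm_factor tau a b) (representsM hN hM).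
rewrite -(comm_factorE tw) in h2.
have := uniq _ _ _ h2 h1 => /(congr1 determinant); rewrite detZ !det_mulmx [X in _ = X]mulrC.
rewrite -[RHS]mul1r => /mulIf h; apply: h; apply: mulf_neq0.
  exact: detn0 Cb hN.
exact: detn0 Ca hM.
Qed.
End FiniteQuotient.

(** * Lower bound *)

Section DevComap.
Variables (R : nzRingType) (q : R) (G : R -> Prop).
Hypotheses (idG : right_ideal G) (qreg : forall x, G (q * x) -> G x).

Definition lshift_ideal (L : R -> Prop) x := exists l g, [/\ L l, G g & x = q * l + g].

Lemma right_ideal_lshift L : right_ideal L -> right_ideal (lshift_ideal L).
Proof.
move=> idL; split.
- by exists 0, 0; split; [exact: ideal0|exact: ideal0|rewrite mulr0 addr0].
- move=> _ _ [l [g [Ll Gg ->]]] [l' [g' [Ll' Gg' ->]]].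
  exists (l - l'), (g - g'); split; [exact: idealB|exact: idealB|].
  by rewrite mulrBr opprD addrACA.
- move=> _ r [l [g [Ll Gg ->]]]; exists (l * r), (g * r).
  by split; [exact: idealM|exact: idealM|rewrite mulrDl mulrA].
Qed.

(** Since left multiplication by [q] is injective modulo [G], the map from [L] to [q L + G] reflects
    inclusions among right ideals containing [G]. Chains can therefore be tested on their images. *)
Lemma devlt_lshift k (J I : R -> Prop) : right_ideal J -> right_ideal I ->
  (forall x, G x -> J x) -> (forall x, G x -> I x) ->
  devlt k (lshift_ideal J) (lshift_ideal I) -> devlt k J I.
Proof.
elim: k J I => [|k IH] J I idJ idI GJ GI /= h.
  move=> x Ix; have [l [g [Jl Gg e]]] : lshift_ideal J (q * x).
    by apply: h; exists x, 0; split; rewrite ?addr0 //; exact: ideal0.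
  rewrite -(subrK l x); apply: idealD => //; apply/GJ/qreg.
  by rewrite mulrBr e addrAC subrr add0r.
move=> c idc Jc cI dec.
have [||||N hN] := h (fun i => lshift_ideal (c i)).
- by move=> i; exact: right_ideal_lshift.
- by move=> i _ [l [g [Jl Gg ->]]]; exists l, g; split=> //; exact: Jc.
- by move=> _ [l [g [Jl Gg ->]]]; exists l, g; split=> //; exact: cI.
- by move=> i _ [l [g [Jl Gg ->]]]; exists l, g; split=> //; exact: dec.
by exists N => i /hN; apply: IH => // x Gx; apply/Jc/GJ.
Qed.
End DevComap.


Section LowerBound.
Variables (F : fieldType) (A : zmodType) (R : algType F) (tau : A -> A -> F) (u : A -> R).
Hypothesis tw : twisted_group_algebra tau u.
Implicit Types (a b c : A) (x y z : R) (s : seq A).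

(** The right ideal generated by the elements [u c - 1]. *)
Fixpoint aug_ideal s x : Prop :=
  if s is c :: s' then exists y g, aug_ideal s' g /\ x = (u c - 1) * y + g else x = 0.

(** Independence is stated in triangular form, each exponent with a linear form that vanishes on the
    later ones: this form is the grading used for the regularity of [u c - 1]. *)
Fixpoint commuting_indep s : Prop :=
  if s is c :: s' then
    [/\ commuting_indep s', forall b, b \in s' -> u c * u b = u b * u c &
     exists l : A -> int, [/\ {morph l : x y / x + y}, 0 < l c & forall b, b \in s' -> l b = 0]]
  else True.

Lemma aug_right_ideal s : right_ideal (aug_ideal s).
Proof.
elim: s => [|c s IH] /=.
  by split=> [//|x y -> ->|x r ->]; rewrite ?subrr ?mul0r.
split.
- by exists 0, 0; split; [exact: ideal0|rewrite mulr0 addr0].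
- move=> _ _ [y [g [Gg ->]]] [y' [g' [Gg' ->]]].
  exists (y - y'), (g - g'); split; first exact: idealB.
  by rewrite (mulrBr (u c - 1)) opprD addrACA.
- move=> _ r [y [g [Gg ->]]]; exists (y * r), (g * r).
  by split; [exact: idealM|rewrite mulrDl mulrA].
Qed.

Lemma aug_lmul s q : (forall b, b \in s -> q * u b = u b * q) ->
  forall x, aug_ideal s x -> aug_ideal s (q * x).
Proof.
elim: s => [|c s IH] /= hq x; first by move->; rewrite mulr0.
move=> [y [g [Gg ->]]]; exists (q * y), (q * g); split.
  by apply: IH => // b bs; apply: hq; rewrite inE bs orbT.
have e : q * (u c - 1) = (u c - 1) * q by rewrite mulrBr mulrBl hq ?mem_head // mulr1 mul1r.
by rewrite mulrDr !mulrA e.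
Qed.

Lemma uinv_comm c b : u c * u b = u b * u c -> uinv tau u c * u b = u b * uinv tau u c.
Proof.
move=> h; apply: (umulI tw (a := c)); rewrite !mulrA (umulV tw) mul1r h.
by rewrite -mulrA (umulV tw) mulr1.
Qed.

Section Grading.
Variable l : A -> int.
Hypothesis lD : {morph l : x y / x + y}.

Lemma degree0 : l 0 = 0.
Proof. by apply: (addrI (l 0)); rewrite -lD !addr0. Qed.
Lemma degreeN a : l (- a) = - l a.
Proof. by apply: (addrI (l a)); rewrite -lD !subrr degree0. Qed.
Lemma degreeB a b : l (a - b) = l a - l b.
Proof. by rewrite lD degreeN. Qed.

Definition homog t x := res u (fun a => l a = t) x.

Lemma homog_umul c t x : homog t (u c * x) = u c * homog (t - l c) x.
Proof.
rewrite -(res_umul tw); apply: (res_eq tw) => a _; rewrite degreeB.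
by split=> [->//|/addIr].
Qed.

(** The generators [u b - 1] are homogeneous of degree 0. *)
Lemma aug_homog s : (forall b, b \in s -> l b = 0) ->
  forall t x, aug_ideal s x -> aug_ideal s (homog t x).
Proof.
elim: s => [|c s IH] /= hl t x; first by move->; rewrite /homog (res0 tw).
move=> [y [g [Gg ->]]]; exists (homog t y), (homog t g); split.
  by apply: IH => // b bs; apply: hl; rewrite inE bs orbT.
rewrite {1}/homog (resD tw) -/(homog _ _) mulrBl mul1r {1}/homog (resB tw) -!/(homog _ _).
by rewrite homog_umul hl ?mem_head // subr0 mulrBl mul1r.
Qed.

Lemma msupp_homog t x a : cf u x a != 0 -> l a = t ->
  (size (msupp u (x - homog t x)) < size (msupp u x))%N.
Proof.
move=> xa la; apply: (@leq_ltn_trans (size [seq b <- msupp u x | b != a])).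
  apply: uniq_leq_size; first exact: (msupp_uniq tw).
  move=> b; rewrite mem_filter !(mem_msupp tw) (cfB tw) /homog (cf_res tw).
  case: asboolP => [_|lb]; first by rewrite subrr eqxx.
  by rewrite subr0 => ->; rewrite andbT; apply: contra_not_neq lb => ->.
rewrite size_filter -(count_predC (pred1 a)) /=.
rewrite -[X in (X < _)%N]add0n ltn_add2r -has_count.
by apply/hasP; exists a; rewrite ?(mem_msupp tw) /=.
Qed.

Section Regular.
Variables (s : seq A) (c : A).
Hypotheses (ls : forall b, b \in s -> l b = 0) (lc : 0 < l c)
  (cs : forall b, b \in s -> u c * u b = u b * u c).

Lemma aug_umulI x : aug_ideal s (u c * x) -> aug_ideal s x.
Proof.
move=> h; rewrite -[x]mul1r -(uVmul tw c) -mulrA; apply: aug_lmul => // b bs.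
by apply: uinv_comm; exact: cs.
Qed.

Lemma top_degree x : x <> 0 -> exists2 t, (exists2 a, cf u x a != 0 & l a = t) &
  forall t', t < t' -> homog t' x = 0.
Proof.
move=> /(cf_neq0 tw)[a0]; rewrite -(mem_msupp tw) => a0s.
have [||a] := @exists_max _ (fun a b => l a <= l b) _ _ a0s.
- by move=> a b _ _; apply/orP; exact: le_total.
- by move=> a b d; exact: le_trans.
rewrite (mem_msupp tw) => xa hm; exists (l a); first by exists a.
move=> t' lt; apply: (res_none tw) => b; rewrite -(mem_msupp tw) => /hm h e.
by move: lt; rewrite -e ltNge h.
Qed.

Lemma bottom_degree x : x <> 0 -> exists2 t, (exists2 a, cf u x a != 0 & l a = t) &
  forall t', t' < t -> homog t' x = 0.
Proof.
move=> /(cf_neq0 tw)[a0]; rewrite -(mem_msupp tw) => a0s.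
have [||a] := @exists_max _ (fun a b => l b <= l a) _ _ a0s.
- by move=> a b _ _; apply/orP; exact: le_total.
- by move=> a b d h h'; exact: le_trans h' h.
rewrite (mem_msupp tw) => xa hm; exists (l a); first by exists a.
move=> t' lt; apply: (res_none tw) => b; rewrite -(mem_msupp tw) => /hm h e.
by move: lt; rewrite -e ltNge h.
Qed.

Lemma homog_aug t x : homog t ((u c - 1) * x) = u c * homog (t - l c) x - homog t x.
Proof. by rewrite mulrBl mul1r {1}/homog (resB tw) -!/(homog _ _) homog_umul. Qed.

(* The top homogeneous component of (u c - 1) x is u c times that of x. *)
Lemma aug_regular x : aug_ideal s ((u c - 1) * x) -> aug_ideal s x.
Proof.
have [k] := ubnP (size (msupp u x)); elim: k x => // k IH x lek h.
have [->|/eqP xn] := eqVneq x 0; first exact: (ideal0 (aug_right_ideal s)).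
have [t [a xa la] ht] := top_degree xn.
have ht' : aug_ideal s (homog t x).
  apply: aug_umulI; have := aug_homog ls (t + l c) h.
  by rewrite homog_aug addrK (ht (t + l c)) ?ltrDl // subr0.
rewrite -(subrK (homog t x) x); apply: (idealD (aug_right_ideal s)) => //.
apply: IH.
  by apply: (leq_trans (msupp_homog xa la)); rewrite -ltnS.
rewrite mulrBr; apply: (idealB (aug_right_ideal s)) => //.
by apply: aug_lmul => // b bs; rewrite mulrBl mulrBr cs // mul1r mulr1.
Qed.

(** If [(u c - 1) * x] is 1 modulo [aug_ideal s], an extreme homogeneous component of [x] lies in
    that ideal and can be removed. Ending with [x = 0] would put 1 in the ideal. *)
Lemma aug_cons_proper : ~ aug_ideal s 1 -> ~ aug_ideal (c :: s) 1.
Proof.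
move=> n1 [x [g [Gg e]]].
have h : aug_ideal s ((u c - 1) * x - 1).
  have -> : (u c - 1) * x - 1 = - g.
    by apply: (addIr 1); rewrite subrK {2}e addrCA addNr addr0.
  exact: (idealN (aug_right_ideal s)).
have [k] := ubnP (size (msupp u x)); elim: k x {e g Gg} h => // k IH x h lek.
have hom1 t : t != 0 -> homog t 1 = 0.
  by move=> t0; apply: (res_none tw) => b /(cf1 tw) ->; rewrite degree0 => /esym; exact/eqP.
have [x0|/eqP xn] := eqVneq x 0.
  apply: n1; rewrite -[1]opprK; apply: (idealN (aug_right_ideal s)).
  by move: h; rewrite x0 mulr0 sub0r.
suff [t [a xa la] ht] : exists2 t, (exists2 a, cf u x a != 0 & l a = t) & aug_ideal s (homog t x).
  apply: (IH (x - homog t x)).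
    rewrite mulrBr addrAC; apply: (idealB (aug_right_ideal s)) => //.
    by apply: aug_lmul => // b bs; rewrite mulrBl mulrBr cs // mul1r mulr1.
  by apply: (leq_trans (msupp_homog xa la)); rewrite -ltnS.
have hh t : aug_ideal s (u c * homog (t - l c) x - homog t x - homog t 1).
  by have := aug_homog ls t h; rewrite {1}/homog (resB tw) -!/(homog _ _) homog_aug.
have [t ta ht] := top_degree xn; have [t' ta' ht'] := bottom_degree xn.
(* The top component works unless its shift hits degree 0, where 1 lives. In that case [t] is
   negative, and so is the bottom degree, whose component then works. *)
have [t0|t0] := eqVneq (t + l c) 0; last first.
  exists t => //; apply: aug_umulI; have := hh (t + l c).
  by rewrite addrK (ht (t + l c)) ?ltrDl // hom1 // !subr0.
exists t' => //; have tt' : t' <= t.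
  by rewrite leNgt; apply/negP => lt; have [a xa la] := ta; have := ht' _ lt;
    move=> /(congr1 (fun z => cf u z a)); rewrite (cf0 tw) (cf_resT tw) // => /eqP; apply/negP.
have := hh t'; rewrite ht' ?hom1; [|lia|lia].
by rewrite mulr0 sub0r subr0 => /(idealN (aug_right_ideal s)); rewrite opprK.
Qed.

Lemma aug_expM j x : aug_ideal s x -> aug_ideal s ((u c - 1) ^+ j * x).
Proof.
apply: aug_lmul => b bs; elim: j => [|j IH]; first by rewrite mul1r mulr1.
by rewrite exprS -mulrA IH !mulrA; congr (_ * _); rewrite mulrBl mulrBr cs // mul1r mulr1.
Qed.
End Regular.
End Grading.

Lemma commuting_indep_cat s1 s2 : commuting_indep (s1 ++ s2) -> commuting_indep s2.
Proof. by elim: s1 => //= c s1 IH [/IH]. Qed.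

Lemma aug_proper s : commuting_indep s -> ~ aug_ideal s 1.
Proof.
elim: s => [_ /eqP|c s IH [/IH h cs [l [lD lc ls]]]]; first by rewrite /= oner_eq0.
exact: (aug_cons_proper lD).
Qed.

(** With [p = u c - 1], every factor of the chain [p ^+ j R + G] is a left shift of [R] modulo
    [p R + G], to which induction applies. Thus each generator moved to [s2] costs one level of
    deviation. *)
Lemma devlt_lower s1 s2 : commuting_indep (s1 ++ s2) ->
  ~ devlt (size s1) (aug_ideal s2) (fun _ => True).
Proof.
elim/last_ind: s1 s2 => [|s1 c IH] s2; first by move=> /aug_proper h /(_ 1 I).
rewrite cat_rcons size_rcons => ci h; have := commuting_indep_cat ci.
move=> /= [_ cs [l [lD lc ls]]]; apply: (IH _ ci).
pose p := u c - 1; pose G := aug_ideal s2.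
have idG : right_ideal G := aug_right_ideal s2.
have pG j x : G x -> G (p ^+ j * x).
  exact: aug_expM.
have preg j x : G (p ^+ j * x) -> G x.
  elim: j => [|j IHj]; first by rewrite mul1r.
  by rewrite exprS -mulrA => /(aug_regular lD ls lc cs)/IHj.
have [||||N hN] := h (fun j => lshift_ideal (p ^+ j) G (fun _ => True)).
- by move=> j; apply: right_ideal_lshift.
- by move=> j x Gx; exists 0, x; split; rewrite ?mulr0 ?add0r.
- by [].
- move=> j _ [y [g [_ Gg ->]]]; exists (p * y), g; split => //.
  by rewrite exprSr mulrA.
have := hN N (leqnn _).
have -> : lshift_ideal (p ^+ N.+1) G (fun _ => True) = lshift_ideal (p ^+ N) G (aug_ideal (c :: s2)).
  apply/predeqP => x; split.
    move=> [y [g [_ Gg ->]]]; exists (p * y), g; split=> //.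
      by exists y, 0; split; [exact: (ideal0 idG)|rewrite addr0].
    by rewrite exprSr mulrA.
  move=> [y [g [[y' [g' [Gg' ->]]] Gg ->]]]; exists y', (p ^+ N * g' + g); split=> //.
    by apply: (idealD idG) => //; exact: pG.
  by rewrite exprSr mulrDr -mulrA addrA mulrA.
apply: (devlt_lshift idG (preg N)) => //.
- exact: aug_right_ideal.
- by move=> x Gx; exists 0, x; rewrite mulr0 add0r.
Qed.

Lemma devlt_commuting s : commuting_indep s -> ~ devlt (size s) (fun x : R => x = 0) (fun _ => True).
Proof. by move=> h; apply: (@devlt_lower s [::]); rewrite cats0. Qed.

End LowerBound.

(** * Upper bound *)

Section Refine.
Variables (F : fieldType) (n : nat) (R : algType F).
Variables (tau : 'rV[int]_n -> 'rV[int]_n -> F) (u : 'rV[int]_n -> R).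
Hypothesis tw : twisted_group_algebra tau u.
Local Notation A := 'rV[int]_n.
Implicit Types (a b : A) (x y z : R) (S : {set 'I_n}).

(** The generator of [R/Q] is torsion over every [F*Z^S] with m coordinates. *)
Definition meets_coord m (Q : R -> Prop) := forall S, #|S| = m ->
  exists z, [/\ z <> 0, sup u (coord_subgroup S) z & Q z].

(** The set [S] measures progress: [C] meets Z^S trivially, so its corank is at least the size of
    [S]. *)
Definition degenerate m (C : A -> Prop) (Q : R -> Prop) S :=
  [/\ isolated C, right_ideal Q, ~ Q 1, coset_graded u C Q &
   meets_coord m Q /\ forall a, C a -> coord_subgroup S a -> a = 0].

Section OffNorm.
Variable S : {set 'I_n}.

Definition off_dot a b : int := \sum_(j | j \notin S) a ord0 j * b ord0 j.
(** The squared Euclidean length outside [S], kept in the natural numbers for induction. *)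
Definition off_norm a : nat := (\sum_(j | j \notin S) `|a ord0 j| ^ 2)%N.

Lemma off_norm_dot a : (off_norm a)%:Z = off_dot a a.
Proof.
rewrite /off_norm /off_dot (big_morph _ PoszD (erefl _)); apply: eq_bigr => j _.
by move: (a ord0 j) => p; lia.
Qed.

Lemma off_dotDl a b c : off_dot (a + b) c = off_dot a c + off_dot b c.
Proof. by rewrite /off_dot -big_split; apply: eq_bigr => j _; rewrite mxE mulrDl. Qed.
Lemma off_dotC a b : off_dot a b = off_dot b a.
Proof. by apply: eq_bigr => j _; rewrite mulrC. Qed.
Lemma off_dotNl a c : off_dot (- a) c = - off_dot a c.
Proof. by rewrite /off_dot -sumrN; apply: eq_bigr => j _; rewrite mxE mulNr. Qed.
Lemma off_dot0l c : off_dot 0 c = 0.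
Proof. by rewrite /off_dot big1 // => j _; rewrite mxE mul0r. Qed.
Lemma off_dotMnl a k c : off_dot (a *+ k) c = off_dot a c *+ k.
Proof. by elim: k => [|k IH]; rewrite ?mulr0n ?off_dot0l // !mulrS off_dotDl IH. Qed.

Lemma off_normD a b : (off_norm (a + b))%:Z = (off_norm a)%:Z + off_dot a b *+ 2 + (off_norm b)%:Z.
Proof.
rewrite !off_norm_dot off_dotDl !(off_dotC _ (a + b)) !off_dotDl (off_dotC b a).
by rewrite mulr2n !addrA.
Qed.

Lemma off_norm_coord a j : j \notin S -> (`|a ord0 j| <= off_norm a)%N.
Proof.
move=> jS; rewrite /off_norm (bigD1 j) //=; apply: leq_trans (leq_addr _ _).
by rewrite -mulnn; case: `|_|%N => // k; rewrite leq_pmulr.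
Qed.

Lemma off_ball_finite (C : A -> Prop) L : (forall a b, C a -> C b -> C (a - b)) ->
  (forall a, C a -> coord_subgroup S a -> a = 0) ->
  exists X : seq A, (forall a, a \in X -> C a) /\
    forall a, C a -> (off_norm a < L)%N -> a \in X.
Proof.
move=> CB inj.
have [[c0 Cc0]|nC] := EM (exists c, C c); last first.
  by exists [::]; split=> // a Ca; case: nC; exists a.
(* Coordinates outside [S] determine a point of [C]. In the ball they lie between [- L] and [L], and
   are shifted by [L] to index a finite type. *)
pose key a : {ffun 'I_n -> 'I_(L + L).+1} :=
  [ffun j => if j \in S then ord0 else inord `|(a ord0 j + L%:Z)%R|%N].
have h (t : {ffun 'I_n -> 'I_(L + L).+1}) : exists a, C a /\
    ((exists a', [/\ C a', (off_norm a' < L)%N & key a' = t]) -> (off_norm a < L)%N /\ key a = t).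
  have [[a [Ca La ka]]|nh] := EM (exists a', [/\ C a', (off_norm a' < L)%N & key a' = t]).
    by exists a.
  by exists c0; split=> // /nh.
have [f hf] := choice h.
exists [seq f t | t <- enum {ffun 'I_n -> 'I_(L + L).+1}]; split.
  by move=> a /mapP[t _ ->]; have [] := hf t.
move=> a Ca La; apply/mapP; exists (key a); first by rewrite mem_enum.
have [Cf hf'] := hf (key a); have [|Lf kf] := hf'; first by exists a.
apply/esym/eqP; rewrite -subr_eq0; apply/eqP; apply: inj; first exact: CB.
move=> j jS; have := congr1 (fun g : {ffun _ -> _} => nat_of_ord (g j)) kf.
have := off_norm_coord a jS; have := off_norm_coord (f (key a)) jS.
rewrite /key !ffunE (negbTE jS) !mxE; move: La Lf; rewrite -/(key a).
move: (a ord0 j) (f (key a) ord0 j) (off_norm a) (off_norm (f (key a))) => p q N N' h1 h2 h3 h4.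
rewrite !inordK; lia.
Qed.
End OffNorm.

(* A quotient of infinite dimension yields exponents a_k, of norm tending to infinity,
   that cannot be rewritten modulo Q by exponents of smaller norm. Their limit direction
   along an ultrafilter orders C, and the initial ideal of Q for it is still proper. *)
Lemma refine m C Q S : degenerate m C Q S -> ~ finite_quotient u C Q ->
  exists C0 Q0 S0, degenerate m C0 Q0 S0 /\ #|S0| = #|S|.+1.
Proof.
move=> [isoC idQ prQ grQ [mQ CS]] nfin.
have [C_0 CB CI] := isoC.
pose nrm := off_norm S.
pose reducible a := exists y, sup u (fun b => C b /\ (nrm b < nrm a)%N) y /\ Q (u a - y).
(* Otherwise every monomial reduces, by induction on its norm, to the finite ball of radius [L], and
   the quotient is finite. *)
have irr L : exists a, [/\ C a, (L <= nrm a)%N & ~ reducible a].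
  apply: contrapT => h; apply: nfin.
  have [X [XC hX]] := off_ball_finite L CB CS; exists X; split=> // a.
  pose K z := exists y, sup u (fun b => b \in X) y /\ Q (z - y).
  have K0 : K 0 by exists 0; rewrite subrr; split; [exact: (sup0 tw)|exact: ideal0].
  have KD x y : K x -> K y -> K (x + y).
    move=> [x' [sx Qx]] [y' [sy Qy]]; exists (x' + y'); split; first exact: (supD tw).
    by rewrite opprD addrACA; exact: idealD.
  have KZ k x : K x -> K (k *: x).
    move=> [x' [sx Qx]]; exists (k *: x'); split; first exact: (supZ tw).
    by rewrite -scalerBr; exact: (idealZ _ idQ).
  have [N] := ubnP (nrm a); elim: N a => // N IH a aN Ca.
  have [aL|La] := ltnP (nrm a) L.
    exists (u a); rewrite subrr; split; last exact: ideal0.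
    by apply: (sup_u tw); exact: hX.
  have [y [sy Qy]] : reducible a by apply: contrapT => nr; apply: h; exists a.
  have [y' [sy' Qy']] : K y.
    apply: (sup_ind tw K0 KD KZ _ sy) => b [Cb ba]; apply: IH => //.
    by apply: leq_trans ba _; rewrite -ltnS.
  exists y'; split=> //; rewrite -(subrK y (u a)) -addrA; exact: idealD.
have [a ha] := choice irr.
have [U ultraU] := free_ultrafilter_exists.
pose dot b k := off_dot S b (a k).
(* Exponents are ordered by the growth of their product with [a k]: [neg] collects those tending to
   minus infinity along [U], and [C0] the bounded ones. *)
pose neg b := C b /\ forall K : nat, U (fun k => dot b k < - K%:Z).
pose C0 b := C b /\ exists K : nat, U (fun k => `|dot b k| <= K%:Z).
have dotD b c k : dot (b + c) k = dot b k + dot c k by exact: off_dotDl.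
have dotN b k : dot (- b) k = - dot b k by exact: off_dotNl.
have negD b c : neg b -> neg c -> neg (b + c).
  move=> [Cb hb] [Cc hc]; split; first exact: isolatedD.
  move=> K; apply: (ultraS ultraU) (ultraI ultraU (hb K) (hc K)) => k [].
  by rewrite dotD; move: (dot b k) (dot c k) => p q; lia.
have negC0 b c : neg b -> C0 c -> neg (b + c).
  move=> [Cb hb] [Cc [K' hc]]; split; first exact: isolatedD.
  move=> K; apply: (ultraS ultraU) (ultraI ultraU (hb (K + K')%N) hc) => k [].
  by rewrite dotD; move: (dot b k) (dot c k) => p q; lia.
have isoC0 : isolated C0.
  split.
  - split=> //; exists 0%N; apply: (ultraT ultraU) => k.
    by rewrite /dot off_dot0l normr0.
  - move=> b c [Cb [K hb]] [Cc [K' hc]]; split; first exact: CB.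
    exists (K + K')%N; apply: (ultraS ultraU) (ultraI ultraU hb hc) => k [].
    by rewrite dotD dotN; move: (dot b k) (dot c k) => p q; lia.
  - move=> b k [Cb [K hb]]; split; first exact: CI Cb.
    exists K; apply: (ultraS ultraU) hb => l; rewrite /dot off_dotMnl; apply: le_trans.
    by rewrite normrMn mulrS lerDl mulrn_wge0.
have total b : C b -> [\/ neg b, neg (- b) | C0 b].
  move=> Cb; have [[K hK]|nb] := EM (exists K : nat, U (fun k => `|dot b k| <= K%:Z)).
    by constructor 3; split=> //; exists K.
  have [hn|/existsNP[K0 hK0]] := EM (forall K : nat, U (fun k => dot b k < - K%:Z)).
    by constructor 1.
  constructor 2; split; first exact: isolatedN.
  move=> K; have big K' : U (fun k => ~ `|dot b k| <= K'%:Z).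
    by have [h|//] := ultraC ultraU (fun k => `|dot b k| <= K'%:Z); case: nb; exists K'.
  have [//|h] := ultraC ultraU (fun k => dot b k < - K0%:Z).
  apply: (ultraS ultraU) (ultraI ultraU h (big (K + K0)%N)) => k []; rewrite dotN.
  by move: (dot b k) => p; lia.
(* Modulo [Q], [u (a k)] would equal [y * u (a k)]. Each exponent [b + a k] of the latter is shorter
   than [a k] once the product of [b] with [a k] is below minus the norm of [b], so [a k] would be
   reducible. *)
have proper y : sup u neg y -> ~ Q (1 - y).
  move=> sy Qy.
  have hU : U (fun k => forall b, b \in msupp u y -> dot b k < - (nrm b)%:Z).
    have : {subset msupp u y <= [pred b | `[< neg b >]]}.
      by move=> b; rewrite (mem_msupp tw) => /sy h; apply/asboolP.
    elim: (msupp u y) => [|b s IH] sub; first exact: (ultraT ultraU).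
    have /asboolP [_ hb] : `[< neg b >] by exact: (sub b (mem_head _ _)).
    have {}IH : U (fun k => forall b, b \in s -> dot b k < - (nrm b)%:Z).
      by apply: IH => c cs; apply: sub; rewrite inE cs orbT.
    apply: (ultraS ultraU) (ultraI ultraU (hb (nrm b)) IH) => k [h1 h2] c.
    by rewrite inE => /orP[/eqP ->|/h2].
  have [k _ hk] := ultra_ex ultraU 0%N hU; have [Ca _] := ha k; apply.
  exists (y * u (a k)); split; last first.
    by have := idealM idQ (u (a k)) Qy; rewrite mulrBl mul1r.
  move=> c /(cf_mul_sup tw)[b [d [yb h2 ->]]].
  have -> : d = a k by move: h2; rewrite (cf_u tw); case: (d =P _); rewrite ?eqxx.
  split; first by apply: isolatedD => //; case: (sy _ yb).
  have := off_normD S b (a k); have := hk b; rewrite (mem_msupp tw) => /(_ yb).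
  rewrite -/nrm -/(dot b k); rewrite mulr2n.
  by move: (dot b k) (nrm (b + a k)) (nrm b) (nrm (a k)) => p N1 N2 N3; lia.
(* If every [j] outside [S] failed, a vector of [C0] with non-zero coordinate [j], and no other
   outside [S], would bound coordinate [j] of [a k]. All norms would then be bounded along [U]. *)
have [j jS hj] : exists2 j, j \notin S & forall b, C0 b -> coord_subgroup (j |: S) b -> b = 0.
  apply: contrapT => nj.
  have h j : exists K : nat, j \notin S -> U (fun k => (`|a k ord0 j| <= K)%N).
    have [jS|jS] := boolP (j \in S); first by exists 0%N.
    have [b [Cb [K hK]] [bS b0]] : exists2 b, C0 b & coord_subgroup (j |: S) b /\ b <> 0.
      apply: contrapT => nb; apply: nj; exists j => // b Cb hb; apply: contrapT => b0.
      by apply: nb; exists b.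
    exists K => _; apply: (ultraS ultraU) hK => k.
    have bj : b ord0 j <> 0.
      move=> bj; apply: b0; apply: CS => // i iS; have [->//|ij] := eqVneq i j.
      by apply: bS; rewrite in_setU1 negb_or ij.
    have -> : dot b k = b ord0 j * a k ord0 j.
      rewrite /dot /off_dot (bigD1 j) //= big1 ?addr0 // => i /andP[iS ij].
      by rewrite bS ?mul0r // in_setU1 negb_or ij.
    move: (b ord0 j) (a k ord0 j) bj => p q p0; rewrite normrM => le.
    have : (1 : int) <= `|p| by lia.
    by move=> p1; rewrite -lez_nat abszE; apply: le_trans le; exact: ler_peMl.
  have [K hK] := choice h.
  have hU : U (fun k => forall j, j \notin S -> (`|a k ord0 j| <= K j)%N).
    apply: (ultra_forall ultraU) => j; have [jS|jS] := boolP (j \in S); first by apply: (ultraT ultraU).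
    by apply: (ultraS ultraU) (hK j jS) => k h' _.
  have [k kb hk] := ultra_ex ultraU (\sum_(j | j \notin S) K j ^ 2).+1%N hU.
  have [_ kn _] := ha k; have : (nrm (a k) <= \sum_(j | j \notin S) K j ^ 2)%N.
    by apply: leq_sum => j jS; rewrite leq_exp2r //; exact: hk.
  by apply/negP; rewrite -ltnNge; exact: leq_trans kb kn.
exists C0, (initial_ideal u Q neg C0), (j |: S); split; last by rewrite cardsU1 jS.
split=> //.
- exact: (initial_right_ideal tw).
- exact: (initial_proper tw).
- exact: (initial_graded tw).
split=> // S' Sm; have [z [z0 sz Qz]] := mQ S' Sm.
by have [z' z'0 [sz' Qz']] := initial_nonzero tw isoC idQ grQ negD negC0 isoC0 total z0 sz Qz; exists z'.
Qed.

(* Maximise the number of coordinates complementary to C over all degenerations. *)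
Lemma proper_ideal_isotropic m Q : right_ideal Q -> ~ Q 1 -> meets_coord m Q ->
  exists S (c : 'I_n -> A), [/\ (#|S| < m)%N,
    forall j, j \notin S -> coord_subgroup (j |: S) (c j) /\ c j ord0 j <> 0 &
    exists2 k, (0 < k)%N & forall i j, i \notin S -> j \notin S ->
      comm_factor tau (c i) (c j) ^+ k = 1].
Proof.
move=> idQ prQ mQ.
pose P k := `[< exists C Q S, degenerate m C Q S /\ #|S| = k >].
have exP : exists k, P k.
  exists 0%N; apply/asboolP; exists (fun _ => True), Q, set0; rewrite cards0; split=> //.
  split=> //; last by split=> // a _; exact: coord_set0.
  by move=> x a Qx; rewrite (res_id tw) // => b.
have bnd k : P k -> (k <= n)%N.
  by move=> /asboolP[C [Q' [S [_ <-]]]]; rewrite -[n in (_ <= n)%N]card_ord; exact: max_card.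
case: (ex_maxnP exP bnd) => k /asboolP[C [Q' [S [deg Sk]]]] kmax.
have [isoC idQ' prQ' grQ' [mQ' CS]] := deg.
have fin : finite_quotient u C Q'.
  apply: contrapT => /(refine deg)[C0 [Q0 [S0 [deg0 S0k]]]].
  suff : (k.+1 <= k)%N by rewrite ltnn.
  by apply: kmax; apply/asboolP; exists C0, Q0, S0; rewrite S0k Sk.
have [N N0 hN] := finite_quotient_torsion tw isoC idQ' prQ' fin.
(* By maximality, [S] cannot be enlarged by [j] with [C] unchanged, so [C] meets Z^(j |: S). *)
have h j : exists c, j \notin S -> [/\ C c, coord_subgroup (j |: S) c & c ord0 j <> 0].
  have [_|jS] := boolP (j \in S); first by exists 0.
  suff [c [Cc cS c0]] : exists c, [/\ C c, coord_subgroup (j |: S) c & c <> 0].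
    exists c => _; split=> // cj; apply: c0; apply: CS => // i iS.
    by have [->//|ij] := eqVneq i j; apply: cS; rewrite in_setU1 negb_or ij.
  apply: contrapT => nc; suff : (k.+1 <= k)%N by rewrite ltnn.
  apply: kmax; apply/asboolP; exists C, Q', (j |: S); rewrite cardsU1 jS Sk; split=> //.
  split=> //; split=> // c Cc cS; apply: contrapT => c0; apply: nc; by exists c.
have [c hc] := choice h; exists S, c; split.
(* Otherwise the ideal has a non-zero element supported in Z^S. Its exponents lie in distinct cosets
   of [C], so homogeneity puts a monomial, which is a unit, in the ideal. *)
- rewrite ltnNge; apply/negP => mS.
  have [S' [S'S S'm]] : exists S', S' \subset S /\ #|S'| = m.
    have : (0 < #|[set B : {set 'I_n} | B \subset S & #|B| == m]|)%N.
      by rewrite cards_draws bin_gt0.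
    by move=> /card_gt0P[B]; rewrite inE => /andP[BS /eqP Bm]; exists B.
  have [z [z0 sz Qz]] := mQ' S' S'm; have [a za] := cf_neq0 tw z0.
  apply: prQ'; have := grQ' z a Qz.
  have -> : res u (fun b => C (b - a)) z = cf u z a *: u a.
    apply: (cf_inj tw) => b; rewrite (cfZ tw) (cf_u tw).
    have [->|ba] := eqVneq b a; first by rewrite mulr1 (cf_resT tw) // subrr; case: isoC.
    rewrite mulr0 (cf_res tw); case: asboolP => // Cb; apply/eqP/negPn/negP => zb.
    have e : b - a = 0.
      apply: CS => // j jS; rewrite !mxE.
      have jS' : j \notin S' by apply: contra jS; exact: (subsetP S'S).
      by rewrite (sz _ zb) // (sz _ za) // subrr.
    by move: ba; rewrite -subr_eq0 e eqxx.
  move=> /(idealM idQ' (uinv tau u a)) /(idealZ (cf u z a)^-1 idQ').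
  by rewrite -scalerAl scalerA mulVf // scale1r (umulV tw).
- by move=> j /hc[].
- exists N => // i j /hc[Ci _ _] /hc[Cj _ _]; exact: hN.
Qed.

Lemma dim_lt_devlt m : (forall J I : R -> Prop, right_ideal J -> right_ideal I ->
    (forall x, J x -> I x) -> dim_lt u m J I -> forall x, I x -> J x) ->
  forall k J I, right_ideal J -> right_ideal I -> (forall x, J x -> I x) ->
  dim_lt u (m + k) J I -> devlt k J I.
Proof.
move=> base; elim=> [|k IH] J I idJ idI JI /=; first by rewrite addn0; exact: base.
rewrite addnS => d c idc Jc cI dec.
have [N hN] := dim_lt_chain tw idJ idI d idc Jc cI dec.
by exists N => i /hN; apply: IH => //; exact: dec.
Qed.

(** In a non-zero factor of torsion dimension below [n - h], an element outside [J] has a proper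
    annihilator modulo [J]. By [proper_ideal_isotropic] this yields an isotropic subgroup of rank
    [n - #|S|], larger than [h]. *)
Lemma devlt_upper h :
  (forall S (c : 'I_n -> A), (h < n - #|S|)%N ->
    (forall j, j \notin S -> coord_subgroup (j |: S) (c j) /\ c j ord0 j <> 0) ->
    ~ exists2 k, (0 < k)%N & forall i j, i \notin S -> j \notin S ->
      comm_factor tau (c i) (c j) ^+ k = 1) ->
  devlt h.+1 (fun x : R => x = 0) (fun _ => True).
Proof.
(* The dimension bound [n - h + h.+1] exceeds [n], so it holds vacuously for the whole algebra. *)
move=> noiso; apply: (@dim_lt_devlt (n - h)) => //; last first.
- move=> S Sc; have := max_card (mem S); rewrite Sc card_ord; lia.
- by split=> [//|x y -> ->|x r ->]; rewrite ?subrr ?mul0r.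
move=> J I idJ idI JI d x Ix; apply: contrapT => nJx.
pose Q r := J (x * r).
have idQ : right_ideal Q.
  split; rewrite /Q.
  - by rewrite mulr0; exact: ideal0.
  - by move=> r s; rewrite mulrBr; exact: idealB.
  - by move=> r s; rewrite mulrA; exact: idealM.
have prQ : ~ Q 1 by rewrite /Q mulr1.
have mQ : meets_coord (n - h) Q by move=> S Sm; exact: d Sm x Ix.
have [S [c [Sm hc iso]]] := proper_ideal_isotropic idQ prQ mQ.
by apply: (noiso S c) => //; move: Sm; lia.
Qed.
End Refine.

Lemma devltS (R : nzRingType) k (J I : R -> Prop) : devlt k J I -> devlt k.+1 J I.
Proof.
elim: k J I => [|k IH] J I h c idc Jc cI dec.
  exists 0%N => i _ x cx; apply: Jc; apply: h; elim: i x cx => [|i IH] x; first exact: cI.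
  by move=> /dec/IH.
by have [N hN] := h c idc Jc cI dec; exists N => i /hN/IH.
Qed.

Lemma devlt_leq (R : nzRingType) k l (J I : R -> Prop) : (k <= l)%N -> devlt k J I -> devlt l J I.
Proof. by move=> /subnK <-; elim: (l - k)%N => //= m IH /IH; exact: devltS. Qed.

(** * Isotropic subspaces *)

Section TorsionUnits.
Variable F : fieldType.
Implicit Types x y : F.

Definition is_torsion x := exists2 k, (0 < k)%N & x ^+ k = 1.

Lemma is_torsion1 : is_torsion 1. Proof. by exists 1%N. Qed.
Lemma is_torsionM x y : is_torsion x -> is_torsion y -> is_torsion (x * y).
Proof.
move=> [k k0 xk] [l l0 yl]; exists (k * l)%N; first by rewrite muln_gt0 k0.
by rewrite exprMn exprM xk expr1n mulnC exprM yl expr1n mulr1.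
Qed.
Lemma is_torsionV x : is_torsion x -> is_torsion x^-1.
Proof. by move=> [k k0 xk]; exists k; rewrite // exprVn xk invr1. Qed.
Lemma is_torsionX x k : (0 < k)%N -> is_torsion (x ^+ k) -> is_torsion x.
Proof. by move=> k0 [l l0 h]; exists (k * l)%N; rewrite ?muln_gt0 ?k0 // exprM. Qed.
End TorsionUnits.

Local Notation toQ := (map_mx (intr : int -> rat)).

Lemma toQ_inj p q : injective (fun M : 'M[int]_(p, q) => toQ M).
Proof.
move=> M N /matrixP h; apply/matrixP => i j; have := h i j; rewrite !mxE.
exact: intr_inj.
Qed.

Lemma clear_denominators p q (V : 'M[rat]_(p, q)) :
  exists k (M : 'M[int]_(p, q)), (0 < k)%N /\ toQ M = k%:R *: V.
Proof.
pose d (ij : 'I_p * 'I_q) := `|denq (V ij.1 ij.2)|%N.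
exists (\prod_ij d ij)%N.
exists (\matrix_(i, j) (numq (V i j) * (\prod_(ij | ij != (i, j)) d ij)%N%:Z)); split.
  by apply: prodn_gt0 => ij; rewrite absz_gt0 denq_neq0.
apply/matrixP => i j; rewrite !mxE.
have -> : (\prod_ij d ij = d (i, j) * \prod_(ij | ij != (i, j)) d ij)%N by rewrite (bigD1 (i, j)).
have dE : (d (i, j))%:R = (denq (V i j))%:~R :> rat by rewrite -[RHS]/((denq (V i j))%:~R) -absz_denq -pmulrn.
by rewrite natrM dE rmorphM /= numqE -pmulrn [_ * V i j]mulrC mulrA.
Qed.

Section Isotropic.
Variables (F : fieldType) (n : nat) (R : algType F).
Variables (tau : 'rV[int]_n -> 'rV[int]_n -> F) (u : 'rV[int]_n -> R).
Hypothesis tw : twisted_group_algebra tau u.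
Local Notation A := 'rV[int]_n.
Local Notation lam := (comm_factor tau).
Implicit Types (a b : A).

(** A rational row space stands for the subgroup of its integral vectors. Passing to finite index
    changes nothing, and ranks become matrix ranks. *)
Definition isotropic p (W : 'M[rat]_(p, n)) := forall a b,
  (toQ a <= W)%MS -> (toQ b <= W)%MS -> is_torsion (lam a b).

Lemma lam0l b : lam 0 b = 1.
Proof.
apply: (mulfI (comm_factor_neq0 tw 0 b)).
by rewrite -(comm_factorDl tw) addr0 mulr1.
Qed.
Lemma lamNl a b : lam (- a) b = (lam a b)^-1.
Proof.
apply: (mulfI (comm_factor_neq0 tw a b)).
by rewrite -(comm_factorDl tw) subrr lam0l mulfV // (comm_factor_neq0 tw).
Qed.
Lemma lamMnl a b k : lam (a *+ k) b = lam a b ^+ k.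
Proof.
by elim: k => [|k IH]; rewrite ?mulr0n ?lam0l // mulrS (comm_factorDl tw) IH exprS.
Qed.
Lemma lamMnr a b k : lam a (b *+ k) = lam a b ^+ k.
Proof. by rewrite comm_factorC lamMnl -exprVn -comm_factorC. Qed.

(** [K] is a subgroup of scalars: the roots of unity in one use, the trivial group in another. *)
Lemma lam_span p (M : 'M[int]_(p, n)) (K : F -> Prop) b : K 1 ->
  (forall x y, K x -> K y -> K (x * y)) -> (forall x, K x -> K x^-1) ->
  (forall i, K (lam (row i M) b)) -> forall w : 'rV[int]_p, K (lam (w *m M) b).
Proof.
move=> K1 KM KV h w; rewrite mulmx_sum_row.
apply: (big_ind (fun c => K (lam c b))) => [|x y hx hy|i _].
- by rewrite lam0l.
- by rewrite (comm_factorDl tw); exact: KM.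
have Kn k : K (lam (row i M *+ k) b).
  by elim: k => [|k IH]; rewrite ?mulr0n ?lam0l // mulrS (comm_factorDl tw); apply: KM.
case: (w ord0 i) => k; first by rewrite -[Posz k]natz scaler_nat.
by rewrite NegzE scaleNr lamNl -[Posz k.+1]natz scaler_nat; apply: KV.
Qed.

Lemma int_span p (M : 'M[int]_(p, n)) a : (toQ a <= toQ M)%MS ->
  exists k (w : 'rV[int]_p), (0 < k)%N /\ a *+ k = w *m M.
Proof.
move=> /submxP[D aE]; have [k [w [k0 wE]]] := clear_denominators D.
exists k, w; split=> //; apply: toQ_inj; rewrite map_mxM wE -scalemxAl -aE.
by rewrite raddfMn /= scaler_nat.
Qed.

Lemma isotropic_gen p (M : 'M[int]_(p, n)) :
  (forall i j, is_torsion (lam (row i M) (row j M))) -> isotropic (toQ M).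
Proof.
move=> h a b /int_span[k [w [k0 aE]]] /int_span[l [v [l0 bE]]].
apply: (is_torsionX k0); rewrite -lamMnl; apply: (is_torsionX l0); rewrite -lamMnr aE bE.
have rS b' : (forall i, is_torsion (lam (row i M) b')) ->
    forall w, is_torsion (lam (w *m M) b').
  apply: lam_span; [exact: is_torsion1|exact: is_torsionM|exact: is_torsionV].
apply: (rS) => i; rewrite comm_factorC; apply: is_torsionV; exact: rS.
Qed.

Lemma lamaa a : lam a a = 1.
Proof. by rewrite /comm_factor mulfV // (tau_neq0 tw). Qed.

Lemma isotropic_line a : isotropic (toQ a).
Proof.
apply: isotropic_gen => i j; rewrite !ord1 lamaa; exact: is_torsion1.
Qed.

Lemma isotropicS p q (W : 'M[rat]_(p, n)) (V : 'M[rat]_(q, n)) :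
  (V <= W)%MS -> isotropic W -> isotropic V.
Proof. by move=> VW h a b aV bV; apply: h; apply: submx_trans VW. Qed.

(** An integral basis of [W], multiplied by a common exponent [N] of the commutation scalars, gives
    commuting monomials. *)
Lemma isotropic_not_devlt p (W : 'M[rat]_(p, n)) : isotropic W ->
  ~ devlt (\rank W) (fun x : R => x = 0) (fun _ => True).
Proof.
move=> isoW; set r := \rank W.
have [k [M [k0 ME]]] := clear_denominators (row_base W).
have kn0 : (k%:R : rat) != 0 by rewrite pnatr_eq0 -lt0n.
have freeM : row_free (toQ M).
  by rewrite ME /row_free (eqmx_scale _ kn0) -/(row_free _) row_base_free.
have /row_freeP[B MB] := freeM.
have [l [B' [l0 B'E]]] := clear_denominators B.
have MB' : M *m B' = l%:R%:M.
  apply: toQ_inj; rewrite map_mxM B'E -scalemxAr MB scalemx1 map_scalar_mx /=.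
  by congr (_%:M); rewrite rmorph_nat.
have torM i j : is_torsion (lam (row i M) (row j M)).
  have hM i' : (toQ (row i' M) <= W)%MS.
    rewrite map_row ME; apply: (submx_trans (row_sub _ _)).
    by rewrite (eqmx_scale _ kn0) eq_row_base.
  exact: isoW.
have [N [N0 hN]] : exists N, (0 < N)%N /\ forall i j, lam (row i M) (row j M) ^+ N = 1.
  have h (ij : 'I_r * 'I_r) : exists N, (0 < N)%N /\ lam (row ij.1 M) (row ij.2 M) ^+ N = 1.
    by have [N N0 hN] := torM ij.1 ij.2; exists N.
  have [f hf] := choice h; exists (\prod_ij f ij)%N; split.
    by apply: prodn_gt0 => ij; have [] := hf ij.
  move=> i j; rewrite (bigD1 (i, j)) //= exprM; have [_ ->] := hf (i, j).
  by rewrite expr1n.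
pose c i := row i M *+ N.
have cc i j : u (c i) * u (c j) = u (c j) * u (c i).
  by rewrite (comm_factorE tw) lamMnl lamMnr hN expr1n scale1r.
(* The columns of the cleared right inverse of [M] are dual linear forms, as required by
   [commuting_indep]. *)
pose f i a : int := (a *m B') ord0 i.
have fD i : {morph f i : x y / x + y} by move=> x y; rewrite /f mulmxDl mxE.
have fMn i a k' : f i (a *+ k') = f i a *+ k'.
  elim: k' => [|k' IH]; first by rewrite !mulr0n /f mul0mx mxE.
  by rewrite !mulrS fD IH.
have fc i j : f i (c j) = (l * N)%N%:Z *+ (j == i).
  rewrite /c fMn /f -row_mul MB' !mxE.
  by case: eqP => _; [rewrite !mulr1n -mulrnA natz|rewrite !mulr0n mul0rn].
suff h (s : seq 'I_r) : uniq s -> commuting_indep u [seq c i | i <- s].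
  have := devlt_commuting tw (h (enum 'I_r) (enum_uniq _)).
  by rewrite size_map size_enum_ord.
elim: s => //= i s IH /andP[iS us]; split; [exact: IH|by move=> b /mapP[j _ ->]|].
exists (f i); split=> //.
  by rewrite fc eqxx mulr1n ltz_nat muln_gt0 l0.
move=> b /mapP[j js ->]; rewrite fc (_ : (j == i) = false) ?mulr0n //.
by apply: contraNF iS => /eqP <-.
Qed.

Lemma isotropic_rank_le d p (W : 'M[rat]_(p, n)) : krull_dim R d -> isotropic W -> (\rank W <= d)%N.
Proof.
move=> [dev _] isoW; rewrite leqNgt; apply/negP => lt.
by apply: (isotropic_not_devlt isoW); exact: devlt_leq dev.
Qed.

Lemma isotropic_rank_ge d : krull_dim R d ->
  exists p (W : 'M[rat]_(p, n)), isotropic W /\ (d <= \rank W)%N.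
Proof.
case: d => [|h] [_ ndev].
  by exists 1%N, (toQ 0); split; [exact: isotropic_line|].
apply: contrapT => no; apply: ndev; apply: (devlt_upper tw) => S c hS hc [k k0 tors].
apply: no; pose T := ~: S.
have cT : #|T| = (n - #|S|)%N.
  by have := cardsC S; rewrite card_ord -/T => h'; rewrite -[n in (n - _)%N]h' addKn.
pose e (i : 'I_#|T|) : 'I_n := enum_val i.
have eS i : e i \notin S by have := enum_valP i; rewrite inE.
pose M : 'M[int]_(#|T|, n) := \matrix_i c (e i).
exists #|T|, (toQ M); split.
  by apply: isotropic_gen => i j; rewrite !rowK; exists k => //; exact: tors.
suff : row_free (toQ M) by move=> /eqP ->; rewrite cT.
(* On the coordinates outside [S] the matrix is diagonal with non-zero entries, so its inverse is
   explicit. *)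
apply/row_freeP; exists (\matrix_(j, i) ((j == e i)%:R / (c j ord0 j)%:~R)).
apply/matrixP => i j; rewrite !mxE (bigD1 (e j)) //= big1 ?addr0; last first.
  by move=> l /negbTE lj; rewrite !mxE lj mul0r mulr0.
rewrite !mxE eqxx mul1r; have [->|ij] := eqVneq i j.
  by rewrite mulfV //= intr_eq0; apply/eqP; have [] := hc _ (eS j).
have [h1 _] := hc _ (eS i); rewrite h1 ?mul0r // in_setU1 negb_or eS andbT.
by apply: contra_neq ij => /enum_val_inj.
Qed.

(** A suitable multiple [a *+ N] has trivial commutation with the unit vectors, so its monomial is
    central, hence scalar. This forces [a *+ N = 0], and the group is torsion-free. *)
Lemma isotropic_radical : center_is_F R ->
  forall a, (forall b, is_torsion (lam a b)) -> a = 0.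
Proof.
move=> cen a ha.
have h (j : 'I_n) : exists N, (0 < N)%N /\ lam a (delta_mx 0 j) ^+ N = 1.
  by have [N N0 hN] := ha (delta_mx 0 j); exists N.
have [f hf] := choice h; pose N := (\prod_j f j)%N.
have N0 : (0 < N)%N by apply: prodn_gt0 => j; have [] := hf j.
have h1 j : lam (delta_mx 0 j) (a *+ N) = 1.
  rewrite comm_factorC lamMnl /N (bigD1 j) //= exprM; have [_ ->] := hf j.
  by rewrite expr1n invr1.
have h2 b : lam b (a *+ N) = 1.
  rewrite -[b]mulmx1; apply: (lam_span (K := fun x => x = 1)) => //.
  - by move=> x y -> ->; rewrite mulr1.
  - by move=> x ->; rewrite invr1.
  - by move=> i; rewrite rowE mulmx1.
have [|k kE] := cen (u (a *+ N)).
  move=> y; apply: (sup_ind tw (K := fun y => u (a *+ N) * y = y * u (a *+ N)) (P := fun _ => True)) => //.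
  - by rewrite mulr0 mul0r.
  - by move=> x z; rewrite mulrDr mulrDl => -> ->.
  - by move=> l x; rewrite -scalerAl -scalerAr => ->.
  by move=> b _; rewrite [RHS](comm_factorE tw) h2 scale1r.
have aN : a *+ N = 0.
  apply: (cf1 tw); have : cf u (u (a *+ N)) (a *+ N) != 0 by rewrite (cf_u tw) eqxx oner_neq0.
  by rewrite {1}kE (cfZ tw) mulf_eq0 negb_or => /andP[].
apply/rowP => j; have := congr1 (fun b : A => b ord0 j) aN.
rewrite mulmxnE !mxE => /eqP; rewrite mulrn_eq0 eqn0Ngt N0 /= => /eqP //.
Qed.
End Isotropic.

Lemma twisted_reindex (F : fieldType) (A B : zmodType) (R : algType F)
    (tau : A -> A -> F) (u : A -> R) (f : B -> A) (g : A -> B) :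
  {morph f : x y / x + y} -> cancel f g -> cancel g f -> twisted_group_algebra tau u ->
  twisted_group_algebra (fun a b => tau (f a) (f b)) (fun a => u (f a)).
Proof.
move=> fD fK gK [[tn0 tc] lin span mul]; split.
- by split=> // a b c; rewrite !fD.
- move=> s c us e a as_.
  have := lin (map f s) (c \o g); rewrite map_inj_uniq; last exact: can_inj fK.
  move=> /(_ us); rewrite big_map.
  have -> : \sum_(b <- s) (c \o g) (f b) *: u (f b) = 0.
    by rewrite -[RHS]e; apply: eq_bigr => b _; rewrite /= fK.
  by move=> /(_ erefl (f a) (map_f f as_)); rewrite /= fK.
- move=> x; have [s [c ->]] := span x; exists (map g s), (c \o f).
  by rewrite big_map; apply: eq_bigr => a _; rewrite /= gK.
- by move=> a b; rewrite mul fD.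
Qed.

(** * Tensor products *)

Section Product.
Variables (F : fieldType) (n1 n2 : nat) (R1 R2 R : algType F).
Variables (tau1 : 'rV[int]_n1 -> 'rV[int]_n1 -> F) (u1 : 'rV[int]_n1 -> R1).
Variables (tau2 : 'rV[int]_n2 -> 'rV[int]_n2 -> F) (u2 : 'rV[int]_n2 -> R2).
Variables (tau : 'rV[int]_(n1 + n2) -> 'rV[int]_(n1 + n2) -> F) (u : 'rV[int]_(n1 + n2) -> R).
Hypotheses (tw1 : twisted_group_algebra tau1 u1) (tw2 : twisted_group_algebra tau2 u2)
  (tw : twisted_group_algebra tau u).
Local Notation lam1 := (comm_factor tau1).
Local Notation lam2 := (comm_factor tau2).
Hypothesis lamE : forall x y v w,
  comm_factor tau (row_mx x v) (row_mx y w) = lam1 x y * lam2 v w.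

Section Subspace.
Variables (p : nat) (W : 'M[rat]_(p, n1 + n2)).
Hypotheses (isoW : isotropic tau W) (freeW : row_free W).

(** The intersection of [W] with the first factor, in the coordinates of that factor. *)
Definition left_kernel := kermx (rsubmx W) *m lsubmx W.

Lemma left_kernelP q (X : 'M_(q, n1)) : (X <= left_kernel)%MS = (row_mx X 0 <= W)%MS.
Proof.
apply/idP/idP => [/submxP[D ->]|/submxP[D e]].
  have -> : row_mx (D *m left_kernel) 0 = D *m (kermx (rsubmx W) *m W).
    rewrite -[X in _ = _ *m (_ *m X)]hsubmxK !mul_mx_row; congr row_mx.
    by rewrite mulmx_ker mulmx0.
  by rewrite mulmxA submxMl.
move: e; rewrite -{1}[W]hsubmxK mul_mx_row => /eq_row_mx[XE DE].
have /submxP[E DE'] : (D <= kermx (rsubmx W))%MS by apply/sub_kermxP.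
by rewrite XE DE' -mulmxA submxMl.
Qed.

Lemma rank_left_kernel : (\rank left_kernel = p - \rank (rsubmx W))%N.
Proof.
have e : kermx (rsubmx W) *m W = row_mx left_kernel 0.
  by rewrite -[X in _ *m X = _]hsubmxK mul_mx_row mulmx_ker.
rewrite -(mxrank_ker (rsubmx W)) -(mxrankMfree _ freeW) e.
by rewrite rank_row_mx0.
Qed.

(** On pairs from [W] the product of the two commutation scalars is torsion; where the second one is
    torsion, so is the first. Adding the left kernel does not alter second components. *)
Lemma isotropic_lift q (X : 'M_(q, n1)) (V : 'M_(q, n2)) : isotropic tau2 V ->
  (row_mx X V <= W)%MS -> isotropic tau1 (left_kernel + X)%MS.
Proof.
move=> isoV XV.
have lift (a : 'rV[int]_n1) : (toQ a <= left_kernel + X)%MS ->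
    exists k v, [/\ (0 < k)%N, (toQ v <= V)%MS & (toQ (row_mx (a *+ k) v) <= W)%MS].
  move=> /sub_addsmxP[[D E] /= aE]; have [k [v [k0 vE]]] := clear_denominators (E *m V).
  exists k, v; split=> //; first by rewrite vE scalemx_sub // submxMl.
  have -> : toQ (row_mx (a *+ k) v) = k%:R *: (row_mx (D *m left_kernel) 0 + E *m row_mx X V).
    rewrite map_row_mx vE raddfMn /= aE mul_mx_row add_row_mx add0r scale_row_mx.
    by rewrite !scaler_nat.
  apply: scalemx_sub; apply: addmx_sub; last by apply: mulmx_sub.
  by rewrite -left_kernelP submxMl.
move=> a b /lift[k [v [k0 vV vW]]] /lift[l [w [l0 wV wW]]].
apply: (is_torsionX k0); rewrite -(lamMnl tw1); apply: (is_torsionX l0); rewrite -(lamMnr tw1).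
have := is_torsionM (isoW vW wW) (is_torsionV (isoV _ _ vV wV)).
by rewrite lamE mulfK // (comm_factor_neq0 tw2).
Qed.

Lemma isotropic_left_kernel : isotropic tau1 left_kernel.
Proof.
have h : isotropic tau1 (left_kernel + (0 : 'M_(1, n1)))%MS.
  apply: (@isotropic_lift _ _ (toQ (0 : 'rV_n2))); first exact: (isotropic_line tw2).
  by rewrite raddf0 row_mx0 sub0mx.
by apply: isotropicS h; exact: addsmxSl.
Qed.

Lemma lift_right (b : 'rV[int]_n2) : (toQ b <= rsubmx W)%MS -> exists k x,
  (0 < k)%N /\ (toQ (row_mx x (b *+ k)) <= W)%MS.
Proof.
move=> /submxP[D bE]; have [k [x [k0 xE]]] := clear_denominators (D *m lsubmx W).
exists k, x; split=> //.
have -> : toQ (row_mx x (b *+ k)) = k%:R *: (D *m W).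
  rewrite -[X in _ *: (_ *m X)]hsubmxK mul_mx_row scale_row_mx map_row_mx xE.
  by rewrite raddfMn /= bE !scaler_nat.
by rewrite scalemx_sub // submxMl.
Qed.

Variables (d1 d2 : nat).
Hypotheses (bnd1 : forall q (V : 'M_(q, n1)), isotropic tau1 V -> (\rank V <= d1)%N)
  (bnd2 : forall q (V : 'M_(q, n2)), isotropic tau2 V -> (\rank V <= d2)%N).
Hypothesis nondeg2 : forall a, (forall b, is_torsion (lam2 a b)) -> a = 0.

(** Every [b] has a multiple that is the second component of some pair in [W]. Pairing with [(0, v)]
    involves only the second factor, so [v] lies in its trivial radical, up to denominators. *)
Lemma full_right_kernel v : row_full (rsubmx W) -> (row_mx (0 : 'rV_n1) v <= W)%MS -> v = 0.
Proof.
move=> full vW; have [k [v' [k0 vE]]] := clear_denominators v.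
have kn0 : (k%:R : rat) != 0 by rewrite pnatr_eq0 -lt0n.
suff v'0 : v' = 0.
  by move: vE; rewrite v'0 raddf0 => /esym/eqP; rewrite scaler_eq0 (negbTE kn0) => /eqP.
apply: nondeg2 => b.
have [l [x [l0 xW]]] := lift_right (submx_full (toQ b) full).
apply: (is_torsionX l0); rewrite -(lamMnr tw2).
have v'W : (toQ (row_mx (0 : 'rV_n1) v') <= W)%MS.
  by rewrite map_row_mx vE raddf0 -[0](scaler0 _ k%:R) -scale_row_mx scalemx_sub.
by have := isoW v'W xW; rewrite lamE (lam0l tw1) mul1r.
Qed.

Lemma rank_full_case q (V : 'M_(q, n2)) : row_full (rsubmx W) -> isotropic tau2 V ->
  (p - n2 + \rank V <= d1)%N.
Proof.
move=> full isoV.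
have isoB : isotropic tau2 (row_base V) by apply: isotropicS isoV; rewrite eq_row_base.
have /submxP[D DE] := submx_full (row_base V) full.
pose X := D *m lsubmx W.
have XW : (row_mx X (row_base V) <= W)%MS.
  have -> : row_mx X (row_base V) = D *m W by rewrite -[X in _ = _ *m X]hsubmxK mul_mx_row -DE.
  exact: submxMl.
have := bnd1 (isotropic_lift isoB XW); apply: leq_trans.
have <- : (\rank left_kernel = p - n2)%N.
  by rewrite rank_left_kernel; move: full => /eqP ->.
(* A combination of lifts that falls into the left kernel gives a vector [(0, v)] in [W], so [v = 0]
   and the combination is trivial: the ranks add up. *)
have freeKX : row_free (col_mx (row_base left_kernel) X).
  apply: inj_row_free => y; rewrite -[y]hsubmxK mul_row_col => e.
  have XK : (rsubmx y *m X <= left_kernel)%MS.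
    have -> : rsubmx y *m X = - (lsubmx y *m row_base left_kernel).
      by apply/eqP; rewrite -addr_eq0 addrC e.
    by rewrite eqmx_opp; apply: (submx_trans (submxMl _ _)); rewrite eq_row_base.
  have y0 : rsubmx y = 0.
    have h : (row_mx 0 (rsubmx y *m row_base V) <= W)%MS.
      have -> : row_mx 0 (rsubmx y *m row_base V) =
          rsubmx y *m row_mx X (row_base V) - row_mx (rsubmx y *m X) 0.
        by rewrite mul_mx_row opp_row_mx add_row_mx subrr subr0.
      apply: addmx_sub; first exact: mulmx_sub.
      by rewrite eqmx_opp -left_kernelP.
    have := full_right_kernel full h => /eqP; rewrite mulmx_free_eq0 ?row_base_free //.
    by move/eqP.
  move: e; rewrite y0 mul0mx addr0 => /eqP; rewrite mulmx_free_eq0 ?row_base_free // => /eqP ->.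
  by rewrite row_mx0.
have -> : (\rank left_kernel + \rank V)%N = \rank (col_mx (row_base left_kernel) X).
  by move/eqP: freeKX => ->.
apply: mxrankS; rewrite col_mx_sub addsmxSr andbT.
by apply: submx_trans (addsmxSl _ _); rewrite eq_row_base.
Qed.

(** If [p] were at least [d1 + n2 - 1], the left kernel would reach the maximal rank [d1] and the
    right projection would have rank [n2 - 1]. That projection turns out isotropic, although its
    rank exceeds [d2]. *)
Lemma rank_small_case : (\rank (rsubmx W) < n2)%N -> (d2 + 2 <= n2)%N -> (p + 2 <= d1 + n2)%N.
Proof.
move=> small dn; rewrite leqNgt; apply/negP => big.
have rK := rank_left_kernel; have K1 := bnd1 isotropic_left_kernel.
have rp : (\rank (rsubmx W) <= p)%N by exact: rank_leq_row.
have Kd : \rank left_kernel = d1 by lia.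
suff /bnd2 : isotropic tau2 (rsubmx W) by lia.
(* A line is isotropic, so adjoining [x] keeps the left kernel isotropic; by maximality of its rank
   [x] is already inside. *)
have inK k x (a : 'rV[int]_n2) : (toQ (row_mx x (a *+ k)) <= W)%MS -> (toQ x <= left_kernel)%MS.
  rewrite map_row_mx => h; have isoKx := isotropic_lift (isotropic_line tw2 (a := a *+ k)) h.
  have := bnd1 isoKx; rewrite -Kd => le.
  apply: submx_trans (addsmxSr left_kernel (toQ x)) _.
  by rewrite -(geq_leqif (mxrank_leqif_sup (addsmxSl left_kernel (toQ x)))).
move=> a b /lift_right[k [x [k0 xW]]] /lift_right[l [y [l0 yW]]].
apply: (is_torsionX k0); rewrite -(lamMnl tw2); apply: (is_torsionX l0); rewrite -(lamMnr tw2).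
have := inK _ _ _ xW; rewrite left_kernelP => xK.
(* Now [(x, 0)] lies in [W] as well, so the scalar of the first factor is torsion by itself and can
   be divided out. *)
have x0W : (toQ (row_mx x 0) <= W)%MS by rewrite map_row_mx raddf0.
have := isoW x0W yW; rewrite lamE (lam0l tw2) mulr1 => torx.
have := is_torsionM (isoW xW yW) (is_torsionV torx).
by rewrite lamE mulrAC mulfV ?mul1r // (comm_factor_neq0 tw1).
Qed.
End Subspace.

Lemma krull_dim_product d1 d2 d : center_is_F R2 ->
  krull_dim R1 d1 -> krull_dim R2 d2 -> krull_dim R d ->
  (2 <= n2 - d2)%N -> (2 <= d2)%N -> (d + 2 <= d1 + n2)%N.
Proof.
move=> cen2 kd1 kd2 kd codim2 d2ge2.
have [p [W [isoW dW]]] := isotropic_rank_ge tw kd.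
have isoB : isotropic tau (row_base W) by apply: isotropicS isoW; rewrite eq_row_base.
have freeB := row_base_free W.
have b1 q (V : 'M_(q, n1)) : isotropic tau1 V -> (\rank V <= d1)%N := isotropic_rank_le tw1 kd1.
have b2 q (V : 'M_(q, n2)) : isotropic tau2 V -> (\rank V <= d2)%N := isotropic_rank_le tw2 kd2.
have [q [V [isoV dV]]] := isotropic_rank_ge tw2 kd2.
apply: leq_trans (_ : \rank W + 2 <= _)%N; first by rewrite leq_add2r.
have [full|nfull] := boolP (row_full (rsubmx (row_base W))).
  have := rank_full_case isoB freeB b1 (isotropic_radical tw2 cen2) full isoV.
  lia.
apply: (rank_small_case isoB freeB b1 b2); last by lia.
by rewrite ltn_neqAle rank_leq_col andbT.
Qed.
End Product.

(** * Reindexing the tensor product and conclusion *)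

Lemma krull_dim_tensor (F : fieldType) (n1 n2 : nat) (R1 R2 R12 : algType F)
    (tau1 : 'rV[int]_n1 -> 'rV[int]_n1 -> F) (tau2 : 'rV[int]_n2 -> 'rV[int]_n2 -> F)
    (u1 : 'rV[int]_n1 -> R1) (u2 : 'rV[int]_n2 -> R2)
    (tau : ('rV[int]_n1 * 'rV[int]_n2)%type -> ('rV[int]_n1 * 'rV[int]_n2)%type -> F)
    (u12 : ('rV[int]_n1 * 'rV[int]_n2)%type -> R12) (d1 d2 d : nat) :
  (forall x y v w, tau (x, v) (y, w) = tau1 x y * tau2 v w) ->
  twisted_group_algebra tau1 u1 -> twisted_group_algebra tau2 u2 ->
  twisted_group_algebra tau u12 -> center_is_F R2 ->
  krull_dim R1 d1 -> krull_dim R2 d2 -> krull_dim R12 d ->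
  (2 <= n2 - d2)%N -> (2 <= d2)%N -> (d + 2 <= d1 + n2)%N.
Proof.
move=> tauE tw1 tw2 tw.
pose f (a : 'rV[int]_(n1 + n2)) := (lsubmx a, rsubmx a).
pose g (a : 'rV[int]_n1 * 'rV[int]_n2) := row_mx a.1 a.2.
have fD : {morph f : x y / x + y} by move=> x y; rewrite /f !raddfD.
have fK : cancel f g by move=> a; exact: hsubmxK.
have gK : cancel g f by move=> [a b]; rewrite /f /g row_mxKl row_mxKr.
apply: (krull_dim_product tw1 tw2 (twisted_reindex fD fK gK tw)).
move=> x y v w; rewrite /comm_factor /f !row_mxKl !row_mxKr !tauE invfM.
by rewrite mulrACA.
Qed.

Theorem theorem5p14 (F : fieldType) (n1 n2 : nat) (R1 R2 R12 : algType F)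
    (tau1 : 'rV[int]_n1 -> 'rV[int]_n1 -> F) (tau2 : 'rV[int]_n2 -> 'rV[int]_n2 -> F)
    (u1 : 'rV[int]_n1 -> R1) (u2 : 'rV[int]_n2 -> R2)
    (u12 : ('rV[int]_n1 * 'rV[int]_n2)%type -> R12)
    (d1 d2 d : nat) :
  twisted_group_algebra tau1 u1 ->
  twisted_group_algebra tau2 u2 ->
  twisted_group_algebra (prod_cocycle tau1 tau2) u12 ->
  center_is_F R1 -> center_is_F R2 ->
  krull_dim R1 d1 -> krull_dim R2 d2 -> krull_dim R12 d ->
  (2 <= n1 - d1)%N -> (2 <= d1)%N ->
  (2 <= n2 - d2)%N -> (2 <= d2)%N ->
  (d < minn (d1 + n2) (d2 + n1) - 1)%N.
Proof.
move=> tw1 tw2 tw cen1 cen2 kd1 kd2 kd codim1 d1ge2 codim2 d2ge2.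
have h12 : (d + 2 <= d1 + n2)%N.
  exact: (krull_dim_tensor (fun _ _ _ _ => erefl) tw1 tw2 tw cen2 kd1 kd2 kd).
(* The second bound is the first one with the tensor factors exchanged. *)
pose swap (A B : zmodType) (a : A * B) := (a.2, a.1).
have swD (A B : zmodType) : {morph @swap A B : x y / x + y} by [].
have swK (A B : zmodType) : cancel (@swap A B) (@swap B A) by case.
have twS := twisted_reindex (swD _ _) (swK 'rV[int]_n2 'rV[int]_n1) (swK _ _) tw.
have h21 : (d + 2 <= d2 + n1)%N.
  apply: (krull_dim_tensor _ tw2 tw1 twS cen1 kd2 kd1 kd codim1 d1ge2).
  by move=> x y v w; rewrite /prod_cocycle mulrC.
by move: h12 h21; lia.
Qed.
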